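(* Let $\Bbbk$ be a field of characteristic zero and let $n>2$ be an integer. For every assignment of a scalar $b_T\in\Bbbk$ to each planar binary tree $T$ with $n$ leaves, consider the variety of (nonassociative) $\Bbbk$-algebras with one bilinear product satisfying the identity $$\sum_T b_T\, m_T(x,\ldots,x)=0,$$ where the sum is over all planar binary trees with $n$ leaves. There exists a nonempty Zariski open subset of the affine space with coordinates $b_T$ such that for every point $(b_T)_T$ of this subset the corresponding variety has the Nielsen–Schreier property.
   Context: For a planar binary tree $T$ with $n$ leaves, $m_T(x_1,\ldots,x_n)$ denotes the nonassociative product of $x_1,\ldots,x_n$ (in this order) with the bracketing according to $T$; for example, for the balanced tree with four leaves, $m_T(x,x,x,x)=(xx)(xx)$. A variety of algebras has the Nielsen–Schreier property if every subalgebra of every free algebra of the variety is free in that variety. *)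

(* Defs.v *)
From HB Require Import structures.
From mathcomp Require Import all_boot all_order all_algebra.
From mathcomp Require Import boolp classical_sets.
From mathcomp Require Import mpoly.

Set Implicit Arguments.
Unset Strict Implicit.
Unset Printing Implicit Defensive.

Import GRing.Theory.

Local Open Scope ring_scope.

Inductive bintree : predArgType :=
| Leaf
| Node of bintree & bintree.

Fixpoint bintree_enc (t : bintree) : GenTree.tree unit :=
  match t with
  | Leaf => GenTree.Leaf tt
  | Node l r => GenTree.Node 0 [:: bintree_enc l; bintree_enc r]
  end.

Fixpoint bintree_dec (g : GenTree.tree unit) : bintree :=
  match g with
  | GenTree.Node _ [:: l; r] => Node (bintree_dec l) (bintree_dec r)
  | _ => Leaf
  end.

Lemma bintree_encK : cancel bintree_enc bintree_dec.
Proof. by elim=> [|l IHl r IHr] //=; rewrite IHl IHr. Qed.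

HB.instance Definition _ := Countable.copy bintree (can_type bintree_encK).

Fixpoint leaves (t : bintree) : nat :=
  match t with
  | Leaf => 1
  | Node l r => leaves l + leaves r
  end.

Fixpoint trees_height (h : nat) : seq bintree :=
  if h is h'.+1 then
    Leaf :: [seq Node l r | l <- trees_height h', r <- trees_height h']
  else [::].

Lemma leaves_gt0 t : (0 < leaves t)%N.
Proof. by elim: t => //= l IHl r _; rewrite addn_gt0 IHl. Qed.

Lemma mem_trees_height h t : (leaves t <= h)%N -> t \in trees_height h.
Proof.
elim: h t => [|h IHh] t; first by rewrite leqNgt leaves_gt0.
case: t => [|l r] /= lt_h; rewrite inE //=.
apply/allpairsP; exists (l, r) => /=; split=> //.
- by apply: IHh; rewrite -ltnS (leq_trans _ lt_h) // -addn1 leq_add2l leaves_gt0.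
- by apply: IHh; rewrite -ltnS (leq_trans _ lt_h) // -add1n leq_add2r leaves_gt0.
Qed.

Record ptree (n : nat) : predArgType := PTree {
  ptree_val :> bintree;
  _ : leaves ptree_val == n
}.

HB.instance Definition _ n := [isSub for @ptree_val n].
HB.instance Definition _ n := [Countable of ptree n by <:].

Lemma ptree_in_height n (t : ptree n) : val t \in trees_height n.
Proof. by case: t => t /= /eqP <-; apply: mem_trees_height. Qed.

Definition ptree_to n (t : ptree n) : seq_sub (trees_height n) :=
  SeqSub (ptree_in_height t).

Definition ptree_from n (u : seq_sub (trees_height n)) : option (ptree n) :=
  insub (val u).

Lemma ptree_toK n : pcancel (@ptree_to n) (@ptree_from n).
Proof. by move=> t; rewrite /ptree_from /= valK. Qed.

HB.instance Definition _ n := isFinite.Build (ptree n)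
  (pcan_enumP (@ptree_toK n)).

HB.mixin Record Lmodule_isNonAssocAlg (K : pzRingType) A of GRing.Lmodule K A := {
  namul : A -> A -> A;
  namul_linearl : forall y : A, linear (namul^~ y);
  namul_linearr : forall x : A, linear (namul x)
}.

#[short(type="naAlgType")]
HB.structure Definition NonAssocAlg (K : pzRingType) :=
  {A of GRing.Lmodule K A & Lmodule_isNonAssocAlg K A}.

Definition is_alg_hom (K : pzRingType) (A B : naAlgType K) (f : A -> B) : Prop :=
  linear f /\ {morph f : x y / namul x y}.

Fixpoint tree_prod (K : pzRingType) (A : naAlgType K) (t : bintree) :
    ('I_(leaves t) -> A) -> A :=
  match t return ('I_(leaves t) -> A) -> A with
  | Leaf => fun x => x ord0
  | Node l r => fun x =>
      namul (tree_prod (fun i => x (lshift (leaves r) i)))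
            (tree_prod (fun i => x (rshift (leaves l) i)))
  end.
Arguments tree_prod {K A} t x.

Record subalgebra (K : pzRingType) (A : naAlgType K) := Subalgebra {
  subalg_set : set A;
  subalg0 : subalg_set 0;
  subalgP : forall (a : K) (x y : A),
    subalg_set x -> subalg_set y -> subalg_set (a *: x + y);
  subalgM : forall x y : A,
    subalg_set x -> subalg_set y -> subalg_set (namul x y)
}.

Section SubalgebraType.
Variables (K : pzRingType) (A : naAlgType K) (S : subalgebra A).

Definition subalg_pred : {pred A} := fun x => `[< subalg_set S x >].

Record subalg_type : predArgType := SubalgElt {
  subalg_val : A;
  _ : subalg_val \in subalg_pred
}.

HB.instance Definition _ := [isSub for subalg_val].
HB.instance Definition _ := [Choice of subalg_type by <:].

Lemma subalg_submod_closed : submod_closed subalg_pred.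
Proof.
split; first by apply/asboolP; apply: subalg0.
by move=> a x y /asboolP Sx /asboolP Sy; apply/asboolP; apply: subalgP.
Qed.

HB.instance Definition _ :=
  GRing.isSubmodClosed.Build K A subalg_pred subalg_submod_closed.
HB.instance Definition _ := [SubChoice_isSubLmodule of subalg_type by <:].

Lemma subalg_namul_closed (x y : subalg_type) :
  namul (val x) (val y) \in subalg_pred.
Proof.
apply/asboolP; apply: subalgM; apply/asboolP; [exact: (valP x)|exact: (valP y)].
Qed.

Definition subalg_namul (x y : subalg_type) : subalg_type :=
  SubalgElt (subalg_namul_closed x y).

Lemma subalg_valP (a : K) (u v : subalg_type) :
  val (a *: u + v) = a *: val u + val v.
Proof. exact: (linearP (val : {linear subalg_type -> A})). Qed.

Lemma subalg_namul_linearl (y : subalg_type) : linear (subalg_namul^~ y).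
Proof.
move=> a u v; apply: val_inj; rewrite subalg_valP.
by rewrite [LHS](congr1 (namul^~ (val y)) (subalg_valP a u v)) namul_linearl.
Qed.

Lemma subalg_namul_linearr (x : subalg_type) : linear (subalg_namul x).
Proof.
move=> a u v; apply: val_inj; rewrite subalg_valP.
by rewrite [LHS](congr1 (namul (val x)) (subalg_valP a u v)) namul_linearr.
Qed.

HB.instance Definition _ := Lmodule_isNonAssocAlg.Build K subalg_type
  subalg_namul_linearl subalg_namul_linearr.

End SubalgebraType.

(** A variety is represented by the class of its algebras. *)
Definition alg_class (K : pzRingType) := naAlgType K -> Prop.

Definition tree_variety (K : pzRingType) (n : nat) (b : {ffun ptree n -> K}) :
    alg_class K :=
  fun A => forall x : A, \sum_(T : ptree n) b T *: tree_prod T (fun=> x) = 0.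

Definition free_on (K : pzRingType) (V : alg_class K) (A : naAlgType K)
    (X : Type) (i : X -> A) : Prop :=
  V A /\
  forall B : naAlgType K, V B -> forall f : X -> B,
    exists! h : A -> B, is_alg_hom h /\ h \o i = f.

Definition is_free (K : pzRingType) (V : alg_class K) (A : naAlgType K) : Prop :=
  exists (X : Type) (i : X -> A), free_on V i.

Definition nielsen_schreier (K : pzRingType) (V : alg_class K) : Prop :=
  forall A : naAlgType K, is_free V A ->
  forall S : subalgebra A, is_free V (subalg_type S).

(** The variable ['X_k] is the coordinate indexed by the [k]-th element of [I];
    the open sets are the complements of the zero loci of arbitrary sets [P] of
    polynomials. *)
Definition zariski_open (K : fieldType) (I : finType) (U : set {ffun I -> K}) :
    Prop :=
  exists P : set {mpoly K[#|I|]}, forall b : {ffun I -> K},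
    U b <-> exists2 p, P p & p.@[fun k => b (enum_val k)] != 0.

(* Main.v *)
Require Import Defs.
From HB Require Import structures.
From mathcomp Require Import all_boot all_order all_algebra.
From mathcomp Require Import boolp classical_sets functions.
From mathcomp Require Import mpoly.

Set Implicit Arguments.
Unset Strict Implicit.
Unset Printing Implicit Defensive.
Import GRing.Theory.
Local Open Scope ring_scope.

(** Write the defining identity of degree [n] as the vanishing of
    [sum_T b_T m_T(x, ..., x)], and let [Phi(x)] be the tensor
    [sum_T b_T m_(T_l)(x, ..., x) (x) m_(T_r)(x, ..., x)] that the multiplication
    maps to it; polarized, [Phi] is a linear map from the symmetric power [S^n A]
    to [A (x) A].

    In a free algebra [A] of the variety the identity is the only source of
    relations between products: the kernel of the multiplication on [A (x) A] is
    the span of the tensors [Phi(x)] ([free_kernel_mul]).  Conversely, let [S] be a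
    graded subalgebra, and choose generators of [S] that form a basis of a
    complement of [S * S] in [S].  If every element of the image of [Phi] lying in
    [S (x) S] is already in [Phi(S^n S)], then a homomorphism out of [S] can be
    built degree by degree from arbitrary values on these generators, since the only
    compatibility to check is the identity itself.  So the Nielsen-Schreier property
    follows from the claim: if [Phi(u)] is in [S (x) S], then [u] is in [S^n S].

    The claim rests on an injectivity statement.  To a combination of trees with
    coefficients [g] attach the combination, of arity one less, whose coefficient at
    [T] is [g (Node Leaf T) - g (Node T Leaf)].  Iterating this on the identity gives
    operations [omega_k] of arity [k = n-1, ..., 2], and [omega_2(x, y)] is a scalar
    [kappa] times [x * y] symmetrized.  If [kappa] is nonzero, the maps
    [omega_k : S^k A -> A], [2 <= k < n], are jointly injective
    ([comm_injective_all]).  Indeed a relation [sum_k omega_k(u_k) = 0] lifts, by the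
    description of the kernel, to a relation between tensors in [A (x) A] involving
    one more term [Phi(u_n)].  Let [a] be a basis vector of least degree [p] occurring
    in the [u_k].  Contracting the left factor against [a] only sees the trees whose
    left branch is a leaf, because a product of two or more vectors of degree at
    least [p] has degree greater than [p]; the same holds on the right.  Subtracting
    the two contractions cancels the contribution of [u_2] and leaves a relation
    between the derivatives of the other [u_k] along [a], again for the operations
    [omega], in lower degree; by induction they vanish, and then [kappa <> 0] disposes
    of [u_2].  The claim about [S] follows from the same contraction argument
    ([outside_letters_vanish]) with [a] of least degree among the basis vectors
    outside [S].

    The scalar [kappa] is a signed sum of the [b_T] over the caterpillar trees, hence
    a nonzero linear form, and the open set is the complement of its zeros.

    A subalgebra need not be graded; it is compared throughout with the graded
    subalgebra formed by the leading components of its elements.  Symmetric tensors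
    are represented by symmetric functions on words whose letters belong to a
    homogeneous basis.  Characteristic zero serves to pass from the identity to its
    homogeneous components. *)

(** * Linear algebra over a field *)

Section LinearMaps.
Variables (K : pzRingType) (V W : lmodType K) (f : V -> W).
Hypothesis f_lin : linear f.

Let F : {linear V -> W} := HB.pack f (GRing.isLinear.Build K V W *:%R f f_lin).

Lemma lin0 : f 0 = 0. Proof. exact: (raddf0 F). Qed.
Lemma linD x y : f (x + y) = f x + f y. Proof. exact: (raddfD F). Qed.
Lemma linB x y : f (x - y) = f x - f y. Proof. exact: (raddfB F). Qed.
Lemma linZ a x : f (a *: x) = a *: f x. Proof. by have := f_lin a x 0; rewrite lin0 !addr0. Qed.
Lemma lin_sum (I : Type) (r : seq I) (P : pred I) (E : I -> V) :
  f (\sum_(i <- r | P i) E i) = \sum_(i <- r | P i) f (E i).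
Proof. exact: (raddf_sum F). Qed.
End LinearMaps.

Section Span.
Local Open Scope classical_set_scope.
Local Open Scope ring_scope.
Variables (K : fieldType) (V : lmodType K).
Implicit Types (G B : set V) (x y : V).

Inductive span G : V -> Prop :=
| span0 : span G 0
| span_cons a x y : G x -> span G y -> span G (a *: x + y).

Lemma mem_span G x : G x -> span G x.
Proof.
by move=> Gx; rewrite -[x]scale1r -[_ *: _]addr0; apply: span_cons => //; apply: span0.
Qed.

Lemma spanP G a x y : span G x -> span G y -> span G (a *: x + y).
Proof.
move=> Gx Gy; elim: Gx => [|c u v Gu _ IH]; first by rewrite scaler0 add0r.
by rewrite scalerDr scalerA -addrA; apply: span_cons.
Qed.

Lemma spanD G x y : span G x -> span G y -> span G (x + y).
Proof. by move=> Gx Gy; rewrite -[x]scale1r; apply: spanP. Qed.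

Lemma spanZ G a x : span G x -> span G (a *: x).
Proof. by move=> Gx; rewrite -[_ *: _]addr0; apply: spanP => //; apply: span0. Qed.

Lemma spanB G x y : span G x -> span G y -> span G (x - y).
Proof. by move=> Gx Gy; rewrite addrC -scaleN1r; apply: spanP. Qed.

Lemma span_sum G (I : eqType) (r : seq I) (P : pred I) (E : I -> V) :
  (forall i, i \in r -> P i -> span G (E i)) -> span G (\sum_(i <- r | P i) E i).
Proof.
move=> H; rewrite big_seq_cond; apply: (big_ind (span G)).
- exact: span0.
- by move=> x y; apply: spanD.
- by move=> i /andP[ri Pi]; apply: H.
Qed.

(** Induction principle: the span is the smallest subspace containing [G]. *)
Lemma span_min G (M : V -> Prop) : M 0 ->
  (forall a x y, M x -> M y -> M (a *: x + y)) -> (forall x, G x -> M x) ->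
  forall x, span G x -> M x.
Proof. by move=> M0 ML GM x; elim=> // a u v Gu _ Mv; apply: ML => //; apply: GM. Qed.

Lemma sub_span G B : (forall x, G x -> span B x) -> forall x, span G x -> span B x.
Proof.
by move=> GB; apply: span_min => //; [apply: span0 | move=> *; apply: spanP].
Qed.

Lemma span_mono G B : G `<=` B -> forall x, span G x -> span B x.
Proof. by move=> GB; apply: sub_span => x /GB; apply: mem_span. Qed.

Lemma span_setU1 G g x : span (G `|` [set g]) x -> exists c, span G (x - c *: g).
Proof.
move: x; apply: span_min => [|a x y [c Hx] [d Hy]|x [Gx| ->]].
- by exists 0; rewrite scale0r subr0; apply: span0.
- exists (a * c + d).
  have -> : a *: x + y - (a * c + d) *: g = a *: (x - c *: g) + (y - d *: g).
    by rewrite scalerBr scalerA scalerDl opprD addrACA.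
  exact: spanP.
- by exists 0; rewrite scale0r subr0; apply: mem_span.
- by exists 1; rewrite scale1r subrr; apply: span0.
Qed.

Lemma span_lin_comb G x : span G x -> exists2 X : seq (K * V),
  (forall p, p \in X -> G p.2) & x = \sum_(p <- X) p.1 *: p.2.
Proof.
elim=> [|a u v Gu _ [X XG ->]]; first by exists [::]; rewrite ?big_nil.
exists ((a, u) :: X); last by rewrite big_cons.
by move=> p; rewrite inE => /orP[/eqP -> //|]; apply: XG.
Qed.

(** Independence in the form that is stable under unions of chains and under adding
    a vector outside the span. *)
Definition indep B := forall b, B b -> ~ span (B `\ b) b.

Lemma indep_neq0 B b : indep B -> B b -> b != 0.
Proof. by move=> Bi Bb; apply/eqP=> b0; apply: (Bi b Bb); rewrite {2}b0; apply: span0. Qed.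

Lemma indep_setU1 B g : indep B -> ~ span B g -> indep (B `|` [set g]).
Proof.
move=> Bi gB b [Bb|->] bs.
- have bg : b <> g by move=> bg; apply: gB; rewrite -bg; apply: mem_span.
  have /span_setU1[c Hc] : span ((B `\ b) `|` [set g]) b.
    apply: span_mono bs => x [[Bx|->] xb]; first by left.
    by right.
  have [c0|cn0] := eqVneq c 0.
    by apply: (Bi b Bb); move: Hc; rewrite c0 scale0r subr0.
  apply: gB; have -> : g = c^-1 *: (b - (b - c *: g)).
    by rewrite subKr scalerA mulVf // scale1r.
  apply: spanZ; apply: spanB; first exact: mem_span.
  by apply: span_mono Hc => x [].
- by apply: gB; apply: span_mono bs => x [[]].
Qed.

(** A maximal independent set between [B0] and [G] exists by Zorn's lemma and spans
    [G].  Keeping both bounds allows nested families of bases adapted to a chain of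
    subspaces. *)
Lemma basis_extend B0 G : indep B0 -> B0 `<=` G ->
  exists B, [/\ B0 `<=` B, B `<=` G, indep B & forall x, G x -> span B x].
Proof.
move=> B0i B0G.
pose P (X : set V) := indep (B0 `|` X) /\ X `<=` G.
have [|X [[Xi XG] Xmax]] := @Zorn_bigcup V P.
  move=> F FP Ftot; split; last by move=> x [X FX Xx]; apply: (FP X FX).2.
  move=> b Bb bs.
  have key x : span ((B0 `|` \bigcup_(X in F) X) `\ b) x ->
      span (B0 `\ b) x \/ exists2 X, F X & span ((B0 `|` X) `\ b) x.
    move: x; apply: span_min.
    - by left; apply: span0.
    - move=> a x y [Hx|[X FX Hx]] [Hy|[Y FY Hy]].
      + by left; apply: spanP.
      + right; exists Y => //; apply: spanP => //.
        by apply: span_mono Hx => z [B0z zb]; split=> //; left.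
      + right; exists X => //; apply: spanP => //.
        by apply: span_mono Hy => z [B0z zb]; split=> //; left.
      + right; have [XY|YX] := Ftot _ _ FX FY.
          exists Y => //; apply: spanP => //; apply: span_mono Hx.
          by move=> z [[B0z|Xz] zb]; split=> //; [left|right; apply: XY].
        exists X => //; apply: spanP => //; apply: span_mono Hy.
        by move=> z [[B0z|Xz] zb]; split=> //; [left|right; apply: YX].
    - move=> x [[B0x|[X FX Xx]] xb]; first by left; apply: mem_span.
      by right; exists X => //; apply: mem_span; split=> //; right.
  case: Bb => [B0b|[Y FY Yb]]; case: (key _ bs) => [H|[X FX H]].
  - exact: (B0i b).
  - by apply: ((FP X FX).1 b) => //; left.
  - apply: ((FP Y FY).1 b); first by right.
    by apply: span_mono H => z [B0z zb]; split=> //; left.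
  - have [XY|YX] := Ftot _ _ FX FY.
      apply: ((FP Y FY).1 b); first by right.
      by apply: span_mono H => z [[B0z|Xz] zb]; split=> //; [left|right; apply: XY].
    by apply: ((FP X FX).1 b) => //; right; apply: YX.
exists (B0 `|` X); split=> //.
- by move=> x [/B0G|/XG].
move=> g Gg; apply: contrapT => gX.
apply: (Xmax (X `|` [set g])); last first.
  split; first by rewrite setUA; apply: indep_setU1.
  by move=> x [/XG|->].
split; first by move=> x Xx; left.
by move=> H; apply: gX; apply: mem_span; right; apply: H; right.
Qed.

End Span.

Section Coordinates.
Local Open Scope classical_set_scope.
Local Open Scope ring_scope.
Variables (K : fieldType) (V : lmodType K) (B : set V).
Hypotheses (B_indep : indep B) (B_span : forall x, span B x).

Definition coord (b x : V) : K :=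
  if pselect (B b) then xget 0 [set c | span (B `\ b) (x - c *: b)] else 0.

Lemma coord_out b x : ~ B b -> coord b x = 0.
Proof. by rewrite /coord; case: pselect. Qed.

Lemma coord_span b x : B b -> span (B `\ b) (x - coord b x *: b).
Proof.
move=> Bb; rewrite /coord; case: pselect => [Bb'|//].
have [|c Hc] := @span_setU1 K V (B `\ b) b x.
  have := B_span x; apply: span_mono => y By.
  by have [->|/eqP yb] := eqVneq y b; [right|left].
exact: (xgetI 0 (Hc : [set c | span (B `\ b) (x - c *: b)] c)).
Qed.

Lemma coordE b x c : B b -> span (B `\ b) (x - c *: b) -> coord b x = c.
Proof.
move=> Bb Hc; apply/eqP; rewrite -subr_eq0; apply/eqP; apply: contrapT => /eqP d0.
apply: (B_indep Bb).
set d := _ - c in d0; have bE : b = d^-1 *: ((x - c *: b) - (x - coord b x *: b)).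
  by rewrite opprB addrC addrA subrK -scalerBl scalerA mulVf // scale1r.
by rewrite [X in span _ X]bE; apply: spanZ; apply: spanB => //; apply: coord_span.
Qed.

Lemma coord_lin b : linear (coord b : V -> K^o).
Proof.
move=> a x y; case: (pselect (B b)) => [Bb|nBb]; last first.
  by rewrite !coord_out // scaler0 addr0.
apply: coordE => //.
have -> : a *: x + y - (a *: (coord b x : K^o) + coord b y) *: b =
    a *: (x - coord b x *: b) + (y - coord b y *: b).
  by rewrite scalerBr scalerA scalerDl opprD addrACA.
by apply: spanP; apply: coord_span.
Qed.

Lemma coord_id b : B b -> coord b b = 1.
Proof. by move=> Bb; apply: coordE => //; rewrite scale1r subrr; apply: span0. Qed.

Lemma coord_eq0 (G : set V) b x : G `<=` B -> ~ G b -> span G x -> coord b x = 0.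
Proof.
move=> GB nGb Gx; case: (pselect (B b)) => [Bb|]; last exact: coord_out.
apply: coordE => //; rewrite scale0r subr0; apply: span_mono Gx => y Gy.
by split; [apply: GB|move=> yb; apply: nGb; rewrite -yb].
Qed.

Lemma coord_basis b b' : B b' -> coord b b' = (b == b')%:R.
Proof.
move=> Bb'; have [->|bb'] := eqVneq b b'; first exact: coord_id.
apply: (@coord_eq0 [set b']); first by move=> y ->.
- by move=> /eqP; rewrite (negPf bb').
- exact: mem_span.
Qed.

Definition covers (r : seq V) (x : V) := x = \sum_(b <- r) coord b x *: b.

Lemma coversE (r : seq V) x : uniq r -> (forall b, b \in r -> B b) ->
  (exists2 X : seq (K * V), (forall p, p \in X -> p.2 \in r) & 
    x = \sum_(p <- X) p.1 *: p.2) -> covers r x.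
Proof.
move=> r_uniq rB [X Xr xE]; rewrite /covers {1}xE.
transitivity (\sum_(b <- r) \sum_(p <- X) (p.1 * (b == p.2)%:R) *: b); last first.
  apply: eq_bigr => b _; rewrite -scaler_suml; congr (_ *: _).
  rewrite xE (lin_sum (@coord_lin b)) big_seq [RHS]big_seq; apply: eq_bigr => p pX.
  by rewrite (linZ (@coord_lin b)) coord_basis //; apply: rB; apply: Xr.
rewrite exchange_big /= big_seq [RHS]big_seq; apply: eq_bigr => p pX.
rewrite (bigD1_seq p.2) ?Xr //= eqxx mulr1 big1 ?addr0 // => b /negPf ->.
by rewrite mulr0 scale0r.
Qed.

(** Finite sums can replace expansions in the whole basis, on any finite set of
    vectors at once. *)
Lemma exists_cover (s : seq V) (r0 : seq V) : (forall b, b \in r0 -> B b) ->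
  exists r : seq V, [/\ uniq r, forall b, b \in r -> B b, {subset r0 <= r} &
    forall x, x \in s -> covers r x].
Proof.
move=> r0B; pose comb (r : seq V) x := exists2 X : seq (K * V),
  (forall p, p \in X -> p.2 \in r) & x = \sum_(p <- X) p.1 *: p.2.
suff [r [rB r0r sr]] : exists r : seq V, [/\ forall b, b \in r -> B b, {subset r0 <= r}
    & forall x, x \in s -> comb r x].
  exists (undup r); split.
  - exact: undup_uniq.
  - by move=> b; rewrite mem_undup; apply: rB.
  - by move=> b /r0r; rewrite mem_undup.
  - move=> x /sr[X Xr xE]; apply: coversE.
    + exact: undup_uniq.
    + by move=> b; rewrite mem_undup; apply: rB.
    + by exists X => // p /Xr; rewrite mem_undup.
elim: s => [|x s [r [rB r0r sr]]]; first by exists r0; split.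
have [X XB xE] := span_lin_comb (B_span x).
exists (r ++ [seq p.2 | p <- X]); split.
- by move=> b; rewrite mem_cat => /orP[/rB //|/mapP[p /XB ? ->]].
- by move=> b /r0r; rewrite mem_cat => ->.
- move=> y; rewrite inE => /orP[/eqP ->|/sr[Y Yr yE]].
    by exists X => // p pX; rewrite mem_cat map_f ?orbT.
  by exists Y => // p /Yr; rewrite mem_cat => ->.
Qed.

Lemma coord_inj x y : (forall b, B b -> coord b x = coord b y) -> x = y.
Proof.
move=> xy; have [|r [_ rB _ cov]] := @exists_cover [:: x; y] [::]; first by [].
have xE : covers r x by apply: cov; rewrite inE eqxx.
have yE : covers r y by apply: cov; rewrite !inE eqxx orbT.
rewrite [LHS]xE [RHS]yE big_seq [RHS]big_seq.
by apply: eq_bigr => b /rB /xy ->.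
Qed.

(** The value at [x] is computed on a finite set of basis vectors covering [x], and
    does not depend on this choice. *)
Lemma basis_map (W : lmodType K) (g : V -> W) :
  exists2 h : V -> W, linear h & forall b, B b -> h b = g b.
Proof.
have /choice[c Hc] x : exists r : seq V, [/\ uniq r, forall b, b \in r -> B b & covers r x].
  have [|r [ru rB _ cov]] := @exists_cover [:: x] [::]; first by [].
  by exists r; split=> //; apply: cov; rewrite inE.
pose h x := \sum_(b <- c x) coord b x *: g b.
have hE r x : uniq r -> (forall b, b \in r -> B b) -> covers r x ->
    h x = \sum_(b <- r) coord b x *: g b.
  have aux r1 r2 : uniq r1 -> uniq r2 -> (forall b, b \in r1 -> B b) ->
      (forall b, b \in r2 -> B b) -> covers r1 x ->
      \sum_(b <- r2) coord b x *: g b = \sum_(b <- r2 | b \in r1) coord b x *: g b.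
    move=> u1 u2 B1 B2 cov; rewrite [RHS]big_mkcond /=.
    apply: eq_big_seq => b br2; case: ifPn => // br1.
    suff -> : coord b x = 0 by rewrite scale0r.
    rewrite cov (lin_sum (@coord_lin b)) big_seq big1 // => b' b'r1.
    rewrite (linZ (@coord_lin b)) (coord_basis b (B1 _ b'r1)).
    by case: eqVneq => [bb'|_]; [move: br1; rewrite bb' b'r1 | rewrite scaler0].
  case: (Hc x) => cu cB cc ru rB cov; rewrite /h (aux r (c x)) // (aux (c x) r) //.
  rewrite -[LHS]big_filter -[RHS]big_filter; apply: perm_big; apply: uniq_perm.
  - exact: filter_uniq.
  - exact: filter_uniq.
  - by move=> b; rewrite !mem_filter andbC.
exists h.
- move=> a x y.
  have [|r [ru rB _ cov]] := @exists_cover [:: x; y; a *: x + y] [::]; first by [].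
  have hr z : z \in [:: x; y; a *: x + y] -> h z = \sum_(b <- r) coord b z *: g b.
    by move=> /cov; apply: hE.
  rewrite !hr ?inE ?eqxx ?orbT // scaler_sumr -big_split /=.
  by apply: eq_bigr => b _; rewrite (@coord_lin b a x y) scalerDl scalerA.
- move=> b Bb; rewrite (hE [:: b]) // ?big_seq1 ?coord_id ?scale1r //.
  + by move=> b'; rewrite inE => /eqP ->.
  + by rewrite /covers big_seq1 coord_id // scale1r.
Qed.

End Coordinates.

Section LinearExtension.
Local Open Scope classical_set_scope.
Local Open Scope ring_scope.
Variables (K : fieldType) (V : lmodType K).

Lemma indep0 : indep (set0 : set V). Proof. by []. Qed.

(** The relation [R] is the graph of a linear map on its domain; values on a basis of
    the domain, completed to a basis of [V], define the extension. *)
Lemma linear_extension (W : lmodType K) (R : V -> W -> Prop) :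
  R 0 0 -> (forall a v w v' w', R v w -> R v' w' -> R (a *: v + v') (a *: w + w')) ->
  (forall w, R 0 w -> w = 0) ->
  exists2 h : V -> W, linear h & forall v w, R v w -> h v = w.
Proof.
move=> R0 RL Rf.
pose D : set V := [set v | exists w, R v w].
have [//|B0 [_ B0D B0i B0s]] := @basis_extend K V set0 D indep0.
have [//|B [B0B _ Bi Bs]] := @basis_extend K V B0 setT B0i.
have {}Bs x : span B x by apply: Bs.
pose g v := xget 0 [set w | R v w].
have Rg b : B0 b -> R b (g b).
  by move=> /B0D[w Rw]; apply: (xgetI 0 (Rw : [set w | R b w] w)).
have [h hl hg] := @basis_map K V B Bi Bs W g.
have hR v : span B0 v -> R v (h v).
  move: v; apply: span_min; first by rewrite (lin0 hl).
    by move=> a x y Hx Hy; rewrite hl; apply: RL.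
  by move=> x B0x; rewrite hg; [apply: Rg|apply: B0B].
exists h => // v w Rw.
have Rv : R v (h v) by apply: hR; apply: B0s; exists w.
apply/eqP; rewrite -subr_eq0; apply/eqP; apply: Rf.
have := RL (-1) _ _ _ _ Rw Rv; rewrite !scaleN1r addNr.
by rewrite addrC.
Qed.

Lemma separation (M : V -> Prop) v : M 0 ->
  (forall a x y, M x -> M y -> M (a *: x + y)) -> ~ M v ->
  exists phi : V -> K^o, [/\ linear phi, forall x, M x -> phi x = 0 & phi v = 1].
Proof.
move=> M0 ML Mv.
pose R (x : V) (c : K^o) := M (x - c *: v).
have [|||phi pl pR] := @linear_extension K^o R.
- by rewrite /R scale0r subr0.
- move=> a x c y d Hx Hy; rewrite /R.
  have -> : a *: x + y - (a *: c + d) *: v = a *: (x - c *: v) + (y - d *: v).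
    by rewrite scalerBr scalerA scalerDl opprD addrACA.
  exact: ML.
- move=> c; rewrite /R sub0r -scalerN => Mc; apply/eqP; apply: contrapT => /negP c0.
  apply: Mv; have := ML (- (c : K)^-1) _ _ Mc M0.
  by rewrite addr0 !scalerN scaleNr opprK scalerA (mulVf (c0 : (c : K) != 0)) scale1r.
exists phi; split=> // [x Mx|]; apply: pR.
  by rewrite /R scale0r subr0.
by rewrite /R scale1r subrr.
Qed.

Lemma nonzero_functional (v : V) : v != 0 ->
  exists2 phi : V -> K^o, linear phi & phi v = 1.
Proof.
move=> /eqP v0; have [//||//|phi [? _ ?]] := @separation (eq^~ 0) v.
  by move=> a x y -> ->; rewrite scaler0 addr0.
by exists phi.
Qed.

End LinearExtension.

(** * Words and tree monomials *)

Section Words.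
Variable I : eqType.
Implicit Types (r w : seq I).

Fixpoint words r (j : nat) : seq (seq I) :=
  if j is j'.+1 then [seq a :: w | a <- r, w <- words r j'] else [:: [::]].

Lemma mem_words r j w : (w \in words r j) = (size w == j) && all (mem r) w.
Proof.
elim: j w => [|j IHj] [|a w] //=; first by apply/allpairsP => -[[b v] []].
rewrite eqSS andbCA -IHj; apply/allpairsP/andP => [[[b v] /= [br vw [-> ->]]]|[ar wj]].
  by split.
by exists (a, w).
Qed.

Lemma words_uniq r j : uniq r -> uniq (words r j).
Proof.
move=> ur; elim: j => //= j IHj; apply: allpairs_uniq => //.
by move=> [a w] [b v] /= _ _ [-> ->].
Qed.

Section Sums.
Variable V : nmodType.
Implicit Types F : seq I -> V.

Lemma sum_wordsS r j F :
  \sum_(w <- words r j.+1) F w = \sum_(a <- r) \sum_(w <- words r j) F (a :: w).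
Proof. by rewrite /= big_allpairs_dep. Qed.

Lemma sum_words_cat r p q F : \sum_(w <- words r (p + q)) F w =
  \sum_(w1 <- words r p) \sum_(w2 <- words r q) F (w1 ++ w2).
Proof.
elim: p F => [|p IHp] F; first by rewrite big_seq1.
by rewrite addSn !sum_wordsS; apply: eq_bigr => a _; rewrite IHp.
Qed.

Lemma sum_words1 r F : \sum_(w <- words r 1) F w = \sum_(a <- r) F [:: a].
Proof. by rewrite sum_wordsS; apply: eq_bigr => a _; rewrite big_seq1. Qed.

Lemma sum_words_sub r0 r1 j F : uniq r0 -> uniq r1 -> {subset r0 <= r1} ->
  (forall w, ~~ all (mem r0) w -> F w = 0) ->
  \sum_(w <- words r1 j) F w = \sum_(w <- words r0 j) F w.
Proof.
move=> u0 u1 r01 F0; rewrite (bigID (fun w => all (mem r0) w)) /=.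
rewrite [X in _ + X]big1 ?addr0 // -big_filter; apply: perm_big.
apply: uniq_perm; rewrite ?filter_uniq ?words_uniq // => w.
rewrite mem_filter !mem_words andbCA; congr andb; apply: andb_idr.
by apply: sub_all => a; apply: r01.
Qed.
End Sums.
End Words.

Lemma trees_height_uniq h : uniq (trees_height h).
Proof.
elim: h => //= h IHh; apply/andP; split.
  by apply/allpairsP => -[[l r] []].
by apply: allpairs_uniq => // -[l r] [l' r'] /= _ _ [-> ->].
Qed.

Lemma leaves_ge2 l r : (2 <= leaves (Node l r))%N.
Proof. by rewrite /= -[2%N]/(1 + 1)%N leq_add ?leaves_gt0. Qed.

(** The list of trees of bounded height contains all trees with at most [n] leaves, so
    increasing the bound by one does not change the sum, and the larger list is by
    construction made of the leaf and of pairs of trees of the smaller one. *)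
Lemma sum_trees_node (V : nmodType) n (F : bintree -> V) :
  (forall T, (n < leaves T)%N -> F T = 0) ->
  \sum_(T <- trees_height n) F T =
  F Leaf + \sum_(l <- trees_height n) \sum_(r <- trees_height n) F (Node l r).
Proof.
move=> F0; have -> : F Leaf + \sum_(l <- trees_height n) \sum_(r <- trees_height n)
    F (Node l r) = \sum_(T <- trees_height n.+1) F T.
  by rewrite /= big_cons big_allpairs_dep.
have small h : \sum_(T <- trees_height h) F T =
    \sum_(T <- trees_height h | (leaves T <= n)%N) F T.
  by rewrite [RHS]big_mkcond; apply: eq_bigr => T _; case: leqP => // /F0.
rewrite small [RHS]small -[LHS]big_filter -[RHS]big_filter; apply: perm_big.
apply: uniq_perm; rewrite ?filter_uniq ?trees_height_uniq // => T.
rewrite !mem_filter; case: leqP => //= Tn.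
by rewrite (mem_trees_height Tn) (mem_trees_height (leqW Tn)).
Qed.

Section TreeEvaluation.
Variables (K : pzRingType) (A : naAlgType K).
Implicit Types (T : bintree) (w : seq A) (x y : A).

(** Monomials on a word instead of a function on ordinals, so that words can be split
    and concatenated without casts. *)
Fixpoint tev T w : A :=
  match T with
  | Leaf => head 0 w
  | Node l r => namul (tev l (take (leaves l) w)) (tev r (drop (leaves l) w))
  end.

Fixpoint tpow T x : A :=
  match T with
  | Leaf => x
  | Node l r => namul (tpow l x) (tpow r x)
  end.

Lemma tree_prod_const T x : tree_prod T (fun=> x) = tpow T x.
Proof. by elim: T => //= l -> r ->. Qed.

Lemma tev_cat l r w1 w2 : size w1 = leaves l ->
  tev (Node l r) (w1 ++ w2) = namul (tev l w1) (tev r w2).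
Proof. by move=> wl /=; rewrite take_size_cat // drop_size_cat. Qed.

Lemma namulDl x y z : namul (x + y) z = namul x z + namul y z.
Proof. exact: (linD (@namul_linearl K A z)). Qed.
Lemma namulDr x y z : namul z (x + y) = namul z x + namul z y.
Proof. exact: (linD (@namul_linearr K A z)). Qed.
Lemma namulZl a x y : namul (a *: x) y = a *: namul x y.
Proof. exact: (linZ (@namul_linearl K A y)). Qed.
Lemma namulZr a x y : namul x (a *: y) = a *: namul x y.
Proof. exact: (linZ (@namul_linearr K A x)). Qed.
Lemma namul0l x : namul 0 x = 0.
Proof. exact: (lin0 (@namul_linearl K A x)). Qed.
Lemma namul0r x : namul x 0 = 0.
Proof. exact: (lin0 (@namul_linearr K A x)). Qed.
Lemma namul_suml I (r : seq I) (P : pred I) (F : I -> A) x :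
  namul (\sum_(i <- r | P i) F i) x = \sum_(i <- r | P i) namul (F i) x.
Proof. exact: (lin_sum (@namul_linearl K A x)). Qed.
Lemma namul_sumr I (r : seq I) (P : pred I) (F : I -> A) x :
  namul x (\sum_(i <- r | P i) F i) = \sum_(i <- r | P i) namul x (F i).
Proof. exact: (lin_sum (@namul_linearr K A x)). Qed.

End TreeEvaluation.

Lemma tpow_expand (K : comPzRingType) (A : naAlgType K) (I : eqType) (r : seq I)
    (al : I -> K) (y : I -> A) T :
  tpow T (\sum_(a <- r) al a *: y a) =
  \sum_(w <- words r (leaves T)) (\prod_(a <- w) al a) *: tev T (map y w).
Proof.
elim: T => [|t1 IH1 t2 IH2].
  by rewrite sum_words1 /=; apply: eq_bigr => a _; rewrite big_seq1.
rewrite [leaves _]/= sum_words_cat /= IH1 IH2 namul_suml.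
apply: eq_big_seq => w1; rewrite mem_words => /andP[/eqP s1 _].
rewrite namul_sumr; apply: eq_bigr => w2 _.
rewrite map_cat take_size_cat ?size_map // drop_size_cat ?size_map //.
by rewrite namulZl namulZr scalerA big_cat.
Qed.

Section Homs.
Variables (K : pzRingType) (A B : naAlgType K) (h : A -> B).
Hypothesis h_hom : is_alg_hom h.

Lemma alg_hom_tpow T x : h (tpow T x) = tpow T (h x).
Proof. by case: h_hom => hl hm; elim: T => //= l IHl r IHr; rewrite hm IHl IHr. Qed.
End Homs.

Section Coefficients.
Variables (K : fieldType) (n : nat).
Implicit Types (b : {ffun ptree n -> K}) (g : bintree -> K).

(** Extension by zero to all trees, which makes the coefficients of an identity and of
    the operations derived from it functions on one type. *)
Definition tree_coef b (T : bintree) : K := if insub T is Some t then b t else 0.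

Lemma tree_coef0 b T : leaves T != n -> tree_coef b T = 0.
Proof. by rewrite /tree_coef; case: insubP => //= t -> _. Qed.

Lemma sum_tree_coef b (V : lmodType K) (F : bintree -> V) :
  \sum_(T : ptree n) b T *: F T = \sum_(T <- trees_height n) tree_coef b T *: F T.
Proof.
rewrite (bigID (fun T => leaves T == n)) /= [X in _ + X]big1 ?addr0; last first.
  by move=> T /tree_coef0 ->; rewrite scale0r.
transitivity (\sum_(T <- [seq val t | t <- enum (ptree n)]) tree_coef b T *: F T).
  rewrite big_map big_enum; apply: eq_bigr => t _.
  by rewrite /tree_coef valK.
rewrite -[RHS]big_filter; apply: perm_big; apply: uniq_perm.
- by rewrite (map_inj_uniq val_inj) enum_uniq.
- by rewrite filter_uniq // trees_height_uniq.
move=> T; rewrite mem_filter; apply/mapP/andP => [[t _ ->]|[Tn _]].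
  by case: t => t /= tn; rewrite tn; split=> //; rewrite mem_trees_height // (eqP tn).
by exists (PTree Tn); rewrite ?mem_enum.
Qed.

Definition satisfies g (A : naAlgType K) :=
  forall x : A, \sum_(T <- trees_height n) g T *: tpow T x = 0.

Lemma tree_varietyE b (A : naAlgType K) :
  tree_variety b A <-> satisfies (tree_coef b) A.
Proof.
suff E x : \sum_(T : ptree n) b T *: tree_prod T (fun=> x) =
    \sum_(T <- trees_height n) tree_coef b T *: tpow T x :> A.
  by split=> H x; [rewrite -E|rewrite E]; apply: H.
rewrite -(sum_tree_coef b (fun T => tpow T x)).
by apply: eq_bigr => T _; rewrite tree_prod_const.
Qed.

End Coefficients.

Section Homogeneous.
Variables (K : fieldType) (charK : [pchar K] =i pred0).

Lemma natf_inj : injective (fun i : nat => i%:R : K).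
Proof.
have H i j : (i <= j)%N -> i%:R = j%:R :> K -> i = j.
  move=> le_ij ij; apply/eqP; rewrite eqn_leq le_ij /= -subn_eq0.
  by rewrite -((pcharf0P K).1 charK) natrB // ij subrr.
move=> i j ij; have [/H|/ltnW/H H'] := leqP i j; first exact.
exact/esym/H'.
Qed.

(** A vector-valued polynomial with infinitely many zeros: apply a linear functional
    that does not vanish on the coefficient in question and count roots. *)
Lemma polynomial_eq0 (V : lmodType K) (I : Type) (r : seq I) (m : I -> nat) (F : I -> V) :
  (forall s : K, \sum_(i <- r) s ^+ m i *: F i = 0) ->
  forall k, \sum_(i <- r | m i == k) F i = 0.
Proof.
move=> H k; apply/eqP; apply: contrapT => /negP /nonzero_functional[phi pl phi1].
pose p : {poly K} := \sum_(i <- r) (phi (F i) : K) *: 'X^(m i).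
have p0 : p = 0.
  pose rs := [seq (i%:R : K) | i <- iota 0 (size p)].
  apply: (@roots_geq_poly_eq0 _ p rs).
  - apply/allP => s _; rewrite rootE horner_sum.
    apply/eqP; rewrite -[RHS](lin0 pl) -(H s) (lin_sum pl).
    by apply: eq_bigr => i _; rewrite (linZ pl) hornerZ hornerXn mulrC.
  - by rewrite map_inj_uniq ?iota_uniq //; apply: natf_inj.
  - by rewrite size_map size_iota.
have := oner_neq0 K; rewrite -phi1 (lin_sum pl) => /eqP; apply.
transitivity (p`_k); last by rewrite p0 coef0.
rewrite coef_sum big_mkcond /=; apply: eq_bigr => i _.
by rewrite coefZ coefXn [k == _]eq_sym; case: eqP; rewrite ?mulr1 ?mulr0.
Qed.

Definition degw (I : Type) (deg : I -> nat) (w : seq I) := sumn (map deg w).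

Lemma degw_cat (I : Type) (deg : I -> nat) w1 w2 :
  degw deg (w1 ++ w2) = (degw deg w1 + degw deg w2)%N.
Proof. by rewrite /degw map_cat sumn_cat. Qed.

Lemma prod_expr_degw (I : Type) (deg : I -> nat) (s : K) w :
  \prod_(a <- w) s ^+ deg a = s ^+ degw deg w.
Proof. by elim: w => [|a w IH]; rewrite ?big_nil ?big_cons //= IH -exprD. Qed.

(** The homogeneous components of an identity are again identities: scale each
    variable by the power of a parameter given by its weight, and compare the
    coefficients of the powers of the parameter. *)
Lemma homogeneous_identity n (g : bintree -> K) (A : naAlgType K) (I : eqType)
    (r : seq I) (y : I -> A) (deg : I -> nat) (al : I -> K) k :
  satisfies n g A ->
  \sum_(T <- trees_height n) g T *: (\sum_(w <- words r (leaves T) | degw deg w == k)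
     (\prod_(a <- w) al a) *: tev T (map y w)) = 0.
Proof.
move=> gA.
pose J := [seq (T, w) | T <- trees_height n, w <- words r (leaves T)].
pose F p := g p.1 *: ((\prod_(a <- p.2) al a) *: tev p.1 (map y p.2)).
transitivity (\sum_(p <- J | degw deg p.2 == k) F p).
  rewrite [RHS]big_mkcond /J big_allpairs_dep; apply: eq_bigr => T _.
  by rewrite scaler_sumr [LHS]big_mkcond.
apply: (@polynomial_eq0 _ _ J (fun p => degw deg p.2) F) => s.
rewrite -[RHS](gA (\sum_(a <- r) (s ^+ deg a * al a) *: y a)).
rewrite /J big_allpairs_dep; apply: eq_bigr => T _; rewrite tpow_expand scaler_sumr.
apply: eq_bigr => w _; rewrite /F /= big_split /= prod_expr_degw !scalerA.
by rewrite mulrCA mulrA.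
Qed.

End Homogeneous.

(** * Joint injectivity of the derived operations *)

Section Commutator.
Variables (K : fieldType) (n : nat).

Definition leaf_comm (g : bintree -> K) (T : bintree) : K :=
  g (Node Leaf T) - g (Node T Leaf).

(** All derived operations packed into one coefficient function: on trees with [k]
    leaves it is the [n - k]-fold derivative of [g]. *)
Definition comm_coef (g : bintree -> K) (T : bintree) : K :=
  if (leaves T <= n)%N then iter (n - leaves T) leaf_comm g T else 0.

Variable g : bintree -> K.

Lemma comm_coef_top T : leaves T = n -> comm_coef g T = g T.
Proof. by move=> Tn; rewrite /comm_coef Tn leqnn subnn. Qed.

Lemma comm_coef_out T : (n < leaves T)%N -> comm_coef g T = 0.
Proof. by rewrite /comm_coef ltnNge; case: (leaves T <= n)%N. Qed.

Lemma comm_coefE T : (leaves T < n)%N ->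
  comm_coef g T = comm_coef g (Node Leaf T) - comm_coef g (Node T Leaf).
Proof.
move=> Tn; rewrite /comm_coef /= addn1 add1n Tn (ltnW Tn).
by rewrite -(subnSK Tn) iterS.
Qed.

(** This is the cancellation of the arity one terms: both branches of the cherry are
    leaves. *)
Lemma comm_coef_leaf : (1 < n)%N -> comm_coef g Leaf = 0.
Proof. by move=> n1; rewrite comm_coefE // subrr. Qed.
End Commutator.

Lemma span_range (K : fieldType) (V : lmodType K) (I : Type) (F : I -> V) z :
  span (range F) z -> exists Y : seq (K * I), z = \sum_(q <- Y) q.1 *: F q.2.
Proof.
elim=> [|a x y [i _ <-] _ [Y ->]]; first by exists [::]; rewrite big_nil.
by exists ((a, i) :: Y); rewrite big_cons.
Qed.

Section Core.
Local Open Scope classical_set_scope.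
Local Open Scope ring_scope.
Variables (K : fieldType) (A : naAlgType K) (n : nat) (g : bintree -> K).
Hypothesis n_gt1 : (1 < n)%N.
Hypothesis g_supp : forall T, leaves T != n -> g T = 0.
Local Notation G := (comm_coef n g).
Hypothesis g_generic : G (Node Leaf Leaf) != 0.
Variables (B : set A) (deg : A -> nat).
Hypotheses (B_indep : indep B) (B_span : forall x, span B x).
Hypothesis deg_gt0 : forall b, B b -> (0 < deg b)%N.
Local Notation coord := (coord B).
Local Notation degw := (degw deg).
Local Notation trees := (trees_height n).

(* The degree of a basis vector only enters through this form of homogeneity. *)
Hypothesis tev_graded : forall T w a, size w = leaves T -> (forall x, x \in w -> B x) ->
  B a -> coord a (tev T w) != 0 -> deg a = degw w.

Let coordB b b' : B b' -> coord b b' = (b == b')%:R :=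
  @coord_basis K A B B_indep B_span b b'.
Let coordL b : linear (coord b : A -> K^o) := @coord_lin K A B B_indep B_span b.

(** The tensor product [A (x) A] is modelled by the matrices of coordinates in the basis. *)
Definition ten (x y : A) : A * A -> K^o := fun p => coord p.1 x * coord p.2 y.

Lemma scale_fctE (a : K) (f : A * A -> K^o) p : (a *: f) p = a * f p.
Proof. by []. Qed.

(** The tensor [Phi(x)]: the multiplication maps it to the value at [x] of the identity. *)
Definition top_product (x : A) : A * A -> K^o :=
  \sum_(l <- trees) \sum_(r <- trees) g (Node l r) *: ten (tpow l x) (tpow r x).

(** The graph of the multiplication map on [A (x) A]. *)
Definition tensor_image (z : A * A -> K^o) (m : A) : Prop :=
  span (range (fun p : A * A => (ten p.1 p.2, namul p.1 p.2) : ((A * A -> K^o) * A)%type))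
    (z, m).

Hypothesis kernel_mul : forall z, tensor_image z 0 -> span (range top_product) z.

Definition symmetric_fun (c : seq A -> K) := forall w w', perm_eq w w' -> c w = c w'.

(** The coordinate at [(a, b)] of the lift to [A (x) A] of the derived operations
    evaluated at the symmetric tensor [c], restricted to the letters in [r]. *)
Definition tens_coef (r : seq A) (c : seq A -> K) (a b : A) : K :=
  \sum_(t1 <- trees) \sum_(t2 <- trees) G (Node t1 t2) *
    \sum_(w1 <- words r (leaves t1)) \sum_(w2 <- words r (leaves t2))
      c (w1 ++ w2) * (coord a (tev t1 w1) * coord b (tev t2 w2)).

(** Joint injectivity in degree [d]: the relation is only required, and the conclusion
    only drawn, for the components of degree [d].  One function [c] carries the
    symmetric tensors of all orders. *)
Definition comm_injective d := forall r c, uniq r -> (forall b, b \in r -> B b) ->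
  symmetric_fun c -> (forall w, (n <= size w)%N -> c w = 0) ->
  (forall b, B b -> deg b = d -> \sum_(T <- trees) G T *
     \sum_(w <- words r (leaves T)) c w * coord b (tev T w) = 0) ->
  forall w, all (mem r) w -> (1 < size w)%N -> degw w = d -> c w = 0.

Lemma degw_gt0 (r w : seq A) : (forall b, b \in r -> B b) -> all (mem r) w ->
  (0 < size w)%N -> (0 < degw w)%N.
Proof.
case: w => //= a w rB /andP[ar _] _; rewrite /degw /=.
by rewrite addn_gt0 deg_gt0 //; apply: rB.
Qed.

Lemma perm_degw w w' : perm_eq w w' -> degw w = degw w'.
Proof. by move=> ww'; rewrite /degw !sumnE; apply: perm_big; apply: perm_map. Qed.

Lemma leaf_in_trees : Leaf \in trees.
Proof. by apply: mem_trees_height; rewrite /= ltnW. Qed.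

(** The contraction argument.  The set [C] is the part of the basis outside a graded
    subalgebra; it is the whole basis in the proof of joint injectivity.  By induction
    on the degree [p] of a letter [a] in [C], the coefficient [c] vanishes on all words
    of degree [d] containing [a]: the coordinates at [(a, b)] and [(b, a)] reduce to the
    terms where [a] is alone on its side, and their difference is a relation of degree
    [d - p] between the values [c (a :: w)]. *)
Lemma outside_letters_vanish d (C : set A) (r : seq A) (c : seq A -> K) :
  (forall d', (d' < d)%N -> comm_injective d') ->
  (forall T w a, size w = leaves T -> (forall x, x \in w -> B x /\ ~ C x) ->
     B a -> C a -> coord a (tev T w) = 0) ->
  uniq r -> (forall b, b \in r -> B b) -> symmetric_fun c ->
  (forall a b, B a -> B b -> (deg a + deg b)%N = d -> C a \/ C b ->
     tens_coef r c a b = 0) ->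
  forall w, all (mem r) w -> (1 < size w <= n)%N -> degw w = d ->
  forall a, a \in w -> C a -> c w = 0.
Proof.
move=> IHd C_closed r_uniq rB c_sym c_tens.
suff main p : forall a, C a -> a \in r -> deg a = p -> forall w, all (mem r) w ->
    (0 < size w < n)%N -> (deg a + degw w)%N = d -> c (a :: w) = 0.
  move=> w wr wn wd a aw Ca; have pw := perm_to_rem aw.
  rewrite (c_sym _ _ pw); apply: (main (deg a)) => //.
  - by apply: (allP wr).
  - by apply/allP => x /mem_rem; apply: (allP wr).
  - by move: wn; rewrite (perm_size pw).
  - by rewrite -wd (perm_degw pw).
elim/ltn_ind: p => p IHp a Ca ar ap.
(* If the branch [t1] is not a leaf, then a nonzero coordinate at [a] forces the word
   [w1] to have degree [p] and at least two letters.  If one of them is in [C], its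
   degree is smaller than [p] and induction applies; otherwise the monomial lies in the
   subalgebra and has no coordinate in [C]. *)
have nonleaf t1 t2 w1 w2 b : t1 != Leaf -> (leaves t1 + leaves t2 <= n)%N ->
    w1 \in words r (leaves t1) -> w2 \in words r (leaves t2) ->
    B b -> (deg a + deg b)%N = d ->
    c (w1 ++ w2) * (coord a (tev t1 w1) * coord b (tev t2 w2)) = 0.
  move=> t1n t12n; rewrite !mem_words => /andP[/eqP s1 w1r] /andP[/eqP s2 w2r] Bb abd.
  have Ba := rB _ ar.
  have [->|a0] := eqVneq (coord a (tev t1 w1)) 0; first by rewrite mul0r mulr0.
  have [->|b0] := eqVneq (coord b (tev t2 w2)) 0; first by rewrite !mulr0.
  have w1B x : x \in w1 -> B x by move=> /(allP w1r); apply: rB.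
  have w2B x : x \in w2 -> B x by move=> /(allP w2r); apply: rB.
  have a_deg := tev_graded s1 w1B Ba a0.
  have b_deg := tev_graded s2 w2B Bb b0.
  have [[a' a'w Ca']|noC] := pselect (exists2 a', a' \in w1 & C a'); last first.
    rewrite (C_closed _ _ a s1) ?mul0r ?mulr0 // => x xw; split; first exact: w1B.
    by move=> Cx; apply: noC; exists x.
  have pw := perm_to_rem a'w.
  have -> : c (w1 ++ w2) = c (a' :: (rem a' w1 ++ w2)).
    by apply: c_sym; rewrite -cat_cons perm_cat2r.
  have t1_gt1 : (1 < leaves t1)%N.
    by case: (t1) t1n => // l r' _; apply: leaves_ge2.
  have rem_r : all (mem r) (rem a' w1).
    by apply/allP => x /mem_rem; apply: (allP w1r).
  have size_rem : (size (rem a' w1)).+1 = leaves t1.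
    by rewrite -s1 (perm_size pw).
  rewrite (IHp (deg a')) ?mul0r //.
  - rewrite -ap a_deg (perm_degw pw) /degw /= -[X in (X < _)%N]addn0 ltn_add2l.
    by apply: (degw_gt0 rB rem_r); rewrite -ltnS size_rem.
  - exact: (allP w1r).
  - by rewrite all_cat rem_r.
  - rewrite size_cat s2 addn_gt0 -ltnS size_rem t1_gt1 /=.
    by rewrite -addSn size_rem.
  - rewrite degw_cat addnA.
    have -> : (deg a' + degw (rem a' w1) = degw w1)%N by rewrite (perm_degw pw).
    by rewrite -a_deg -b_deg.
have left_leaf b : B b -> (deg a + deg b)%N = d ->
    \sum_(T <- trees) G (Node Leaf T) *
      \sum_(w <- words r (leaves T)) c (a :: w) * coord b (tev T w) = 0.
  move=> Bb abd; rewrite -[RHS](c_tens a b (rB _ ar) Bb abd (or_introl Ca)).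
  rewrite /tens_coef [RHS](bigD1_seq Leaf) ?leaf_in_trees ?trees_height_uniq //=.
  rewrite [X in _ = _ + X]big1 ?addr0.
    apply: eq_bigr => T _; congr (_ * _); rewrite exchange_big.
    apply: eq_bigr => w _; rewrite sum_words1 (bigD1_seq a) //= big1_seq ?addr0.
      by rewrite (coordB _ (rB _ ar)) eqxx mul1r.
    move=> a' /andP[a'a a'r]; rewrite (coordB _ (rB _ a'r)).
    by rewrite eq_sym (negPf a'a) mul0r mulr0.
  move=> t1 t1n; rewrite big1 // => t2 _.
  have [t12|t12] := leqP (leaves t1 + leaves t2) n; last first.
    by rewrite comm_coef_out ?mul0r.
  rewrite big1_seq ?mulr0 // => w1 /andP[_ w1r].
  by rewrite big1_seq // => w2 /andP[_ w2r]; apply: nonleaf.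
have right_leaf b : B b -> (deg a + deg b)%N = d ->
    \sum_(T <- trees) G (Node T Leaf) *
      \sum_(w <- words r (leaves T)) c (a :: w) * coord b (tev T w) = 0.
  move=> Bb abd; rewrite addnC in abd.
  rewrite -[RHS](c_tens b a Bb (rB _ ar) abd (or_intror Ca)).
  rewrite /tens_coef exchange_big.
  rewrite [RHS](bigD1_seq Leaf) ?leaf_in_trees ?trees_height_uniq //=.
  rewrite [X in _ = _ + X]big1 ?addr0.
    apply: eq_bigr => T _; congr (_ * _).
    apply: eq_bigr => w _; rewrite sum_words1 (bigD1_seq a) //= big1_seq ?addr0.
      rewrite (coordB _ (rB _ ar)) eqxx mulr1.
      by congr (_ * _); apply: c_sym; rewrite cats1 perm_sym perm_rcons.
    move=> a' /andP[a'a a'r]; rewrite (coordB _ (rB _ a'r)).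
    by rewrite eq_sym (negPf a'a) !mulr0.
  move=> t1 t1n; rewrite big1 // => t2 _.
  have [t12|t12] := leqP (leaves t2 + leaves t1) n; last first.
    by rewrite comm_coef_out ?mul0r.
  rewrite big1_seq ?mulr0 // => w1 /andP[_ w1r].
  rewrite big1_seq // => w2 /andP[_ w2r].
  rewrite (c_sym _ (w2 ++ w1)) 1?perm_catC // [X in _ * X]mulrC.
  by apply: nonleaf => //; rewrite addnC.
(* Words with at least two further letters: induction on the degree. *)
have long w : all (mem r) w -> (1 < size w < n)%N -> (deg a + degw w)%N = d ->
    c (a :: w) = 0.
  move=> wr /andP[w1 wn] aw.
  pose ca (v : seq A) := if (size v < n)%N then c (a :: v) else 0.
  suff : ca w = 0 by rewrite /ca wn.
  have wd : (degw w < d)%N.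
    by rewrite -aw -[X in (X < _)%N]add0n ltn_add2r deg_gt0 //; apply: rB.
  apply: (IHd _ wd r ca) => //.
  - move=> v v' vv'; rewrite /ca (perm_size vv'); case: ifP => // _.
    by apply: c_sym; rewrite perm_cons.
  - by move=> v; rewrite /ca ltnNge => ->.
  - move=> b Bb bw; have abd : (deg a + deg b)%N = d by rewrite bw.
    have E := congr2 (fun x y : K => x - y) (left_leaf b Bb abd) (right_leaf b Bb abd).
    rewrite /= subr0 in E; rewrite -[RHS]E -sumrB; apply: eq_bigr => T _; rewrite -mulrBl.
    have [Tn|Tn|Tn] := ltngtP (leaves T) n.
    + rewrite comm_coefE //; congr (_ * _); apply: eq_big_seq => v.
      by rewrite mem_words /ca => /andP[/eqP -> _]; rewrite Tn.
    + by rewrite !comm_coef_out ?subr0 ?mul0r //= ?addn1 ?add1n ltnS ltnW.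
    + rewrite (@comm_coef_out _ _ _ (Node Leaf T)) ?(@comm_coef_out _ _ _ (Node T Leaf)) /=;
        rewrite ?addn1 ?add1n ?Tn //.
      rewrite subr0 mul0r big1_seq ?mulr0 // => v.
      by rewrite mem_words /ca => /andP[_ /andP[/eqP vT _]]; rewrite vT ltnn mul0r.
move=> w wr /andP[w0 wn] awd; have [w1|w1] := ltnP 1 (size w).
  by apply: long; rewrite ?w1.
(* With a single further letter [b], the relation on the left only retains the cherry,
   whose coefficient is nonzero. *)
case: w wr w0 wn awd w1 => // b [|//] /= /andP[br _] _ _ awd _.
have Bb := rB _ br.
have abd : (deg a + deg b)%N = d by rewrite -awd /degw /= addn0.
have /eqP := left_leaf b Bb abd.
rewrite (bigD1_seq Leaf) ?leaf_in_trees ?trees_height_uniq //=.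
rewrite [X in _ + X]big1_seq ?addr0.
  rewrite sum_words1 (bigD1_seq b) //= big1_seq ?addr0.
    by rewrite (coordB _ Bb) eqxx mulr1 mulf_eq0 (negPf g_generic) => /eqP.
  move=> a' /andP[a'b a'r]; rewrite (coordB _ (rB _ a'r)).
  by rewrite eq_sym (negPf a'b) mulr0.
move=> T /andP[Tl _].
have T_gt1 : (1 < leaves T)%N by case: (T) Tl => // l r' _; apply: leaves_ge2.
have [Tn|Tn] := ltnP (leaves T) n; last first.
  by rewrite comm_coef_out ?mul0r //= add1n ltnS.
rewrite big1_seq ?mulr0 // => v /andP[_]; rewrite mem_words => /andP[/eqP vT vr].
have [->|b0] := eqVneq (coord b (tev T v)) 0; first by rewrite mulr0.
rewrite long ?mul0r ?vT ?T_gt1 //.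
rewrite -(tev_graded vT _ Bb b0) // => x /(allP vr); exact: rB.
Qed.

(** The coefficients on words of a linear combination of powers of the
    vectors listed in [Y]. *)
Definition power_coef (Y : seq (K * A)) (w : seq A) : K :=
  \sum_(q <- Y) q.1 * \prod_(a <- w) coord a q.2.

Lemma power_coef_sym Y : symmetric_fun (power_coef Y).
Proof. by move=> w w' ww'; apply: eq_bigr => q _; congr (_ * _); apply: perm_big. Qed.

(** A combination of tensors [Phi(x)] only involves words of length [n], on which the
    derived operations are the identity itself. *)
Lemma top_products_coef (Y : seq (K * A)) r a b :
  (forall q, q \in Y -> covers B r q.2) ->
  (\sum_(q <- Y) q.1 *: top_product q.2) (a, b) =
  tens_coef r (fun w => if size w == n then power_coef Y w else 0) a b.
Proof.
move=> cov; rewrite fct_sumE /tens_coef.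
transitivity (\sum_(q <- Y) \sum_(t1 <- trees) \sum_(t2 <- trees)
   q.1 * (g (Node t1 t2) * (coord a (tpow t1 q.2) * coord b (tpow t2 q.2)))).
  apply: eq_bigr => q _; rewrite scale_fctE /top_product fct_sumE mulr_sumr.
  by apply: eq_bigr => t1 _; rewrite fct_sumE mulr_sumr.
rewrite exchange_big; apply: eq_bigr => t1 _.
rewrite exchange_big; apply: eq_bigr => t2 _.
have [t12|t12] := eqVneq (leaves t1 + leaves t2)%N n; last first.
  rewrite big1 => [|q _]; last by rewrite g_supp // mul0r mulr0.
  rewrite big1_seq ?mulr0 // => w1 /andP[_]; rewrite mem_words => /andP[/eqP s1 _].
  rewrite big1_seq // => w2 /andP[_]; rewrite mem_words => /andP[/eqP s2 _].
  by rewrite size_cat s1 s2 (negPf t12) mul0r.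
rewrite comm_coef_top // mulr_sumr.
transitivity (\sum_(q <- Y) \sum_(w1 <- words r (leaves t1))
    \sum_(w2 <- words r (leaves t2)) g (Node t1 t2) *
    (q.1 * \prod_(i <- w1 ++ w2) coord i q.2 *
      (coord a (tev t1 w1) * coord b (tev t2 w2)))).
  apply: eq_big_seq => q qY; rewrite mulrCA.
  have E t e : coord e (tpow t q.2) = \sum_(w <- words r (leaves t))
      (\prod_(i <- w) coord i q.2) * coord e (tev t w).
    rewrite {1}(cov q qY) (@tpow_expand _ _ _ r (fun i => coord i q.2) id).
    rewrite (lin_sum (@coordL e)); apply: eq_bigr => w _.
    by rewrite (linZ (@coordL e)) map_id.
  rewrite (E t1 a) (E t2 b) mulr_suml !mulr_sumr; apply: eq_bigr => w1 _.
  rewrite !mulr_sumr; apply: eq_bigr => w2 _.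
  by rewrite big_cat /= -(mulrA q.1) [in RHS]mulrACA.
rewrite exchange_big; apply: eq_big_seq => w1; rewrite mem_words => /andP[/eqP s1 _].
rewrite exchange_big mulr_sumr; apply: eq_big_seq => w2.
rewrite mem_words => /andP[/eqP s2 _].
by rewrite -mulr_sumr size_cat s1 s2 t12 eqxx /power_coef mulr_suml.
Qed.

Lemma tensor_imageP a x y p q : tensor_image x p -> tensor_image y q ->
  tensor_image (a *: x + y) (a *: p + q).
Proof. by move=> Hx Hy; apply: (spanP a Hx Hy). Qed.

Lemma tensor_imageZ a x p : tensor_image x p -> tensor_image (a *: x) (a *: p).
Proof. by move=> Hx; apply: (spanZ a Hx). Qed.

Lemma tensor_image_sum (I : eqType) (r : seq I) (E : I -> A * A -> K^o) (F : I -> A) :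
  (forall i, i \in r -> tensor_image (E i) (F i)) ->
  tensor_image (\sum_(i <- r) E i) (\sum_(i <- r) F i).
Proof.
elim: r => [|i r IHr] H; first by rewrite !big_nil; apply: span0.
rewrite !big_cons -[E i]scale1r -[F i]scale1r; apply: tensor_imageP.
  by apply: H; rewrite mem_head.
by apply: IHr => j jr; apply: H; rewrite inE jr orbT.
Qed.

Lemma tensor_image_ten x y : tensor_image (ten x y) (namul x y).
Proof. by apply: mem_span; exists (x, y). Qed.

Lemma tens_coef_sub r r1 (c : seq A -> K) a b : uniq r -> uniq r1 -> {subset r <= r1} ->
  tens_coef r1 (fun v => if all (mem r) v then c v else 0) a b = tens_coef r c a b.
Proof.
move=> ur ur1 r01; apply: eq_bigr => t1 _; apply: eq_bigr => t2 _; congr (_ * _).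
rewrite (@sum_words_sub _ _ r r1) // => [|v vr]; last first.
  by apply: big1 => v' _; rewrite all_cat (negPf vr) mul0r.
apply: eq_big_seq => v; rewrite mem_words => /andP[_ vr].
rewrite (@sum_words_sub _ _ r r1) // => [|v' v'r]; last first.
  by rewrite all_cat (negPf v'r) andbF mul0r.
apply: eq_big_seq => v'; rewrite mem_words => /andP[_ v'r].
by rewrite all_cat vr v'r.
Qed.

Lemma tens_coefB r (c c' : seq A -> K) a b :
  tens_coef r (fun v => c v - c' v) a b = tens_coef r c a b - tens_coef r c' a b.
Proof.
rewrite -sumrB; apply: eq_bigr => t1 _; rewrite -sumrB; apply: eq_bigr => t2 _.
rewrite -mulrBr; congr (_ * _); rewrite -sumrB; apply: eq_bigr => v _.
by rewrite -sumrB; apply: eq_bigr => v' _; rewrite mulrBl.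
Qed.

(** Induction on the degree.  The part of degree [d] of the relation holds exactly, so
    its lift to [A (x) A] is in the kernel of the multiplication, hence a combination of
    tensors [Phi(x)].  The difference of the two is encoded by a function [c1] that agrees
    with [c] on the words of length less than [n] and degree [d], and whose coordinates
    all vanish. *)
Theorem comm_injective_all d : comm_injective d.
Proof.
elim/ltn_ind: d => d IHd r c r_uniq rB c_sym c_big c_rel w wr w_gt1 wd.
have [wn|/c_big //] := ltnP (size w) n.
pose cd (v : seq A) := if degw v == d then c v else 0.
pose z : A * A -> K^o := \sum_(t1 <- trees) \sum_(t2 <- trees)
  \sum_(w1 <- words r (leaves t1)) \sum_(w2 <- words r (leaves t2))
    (G (Node t1 t2) * cd (w1 ++ w2)) *: ten (tev t1 w1) (tev t2 w2).
pose m := \sum_(T <- trees) G T *: \sum_(v <- words r (leaves T)) cd v *: tev T v.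
have z_m : tensor_image z m.
  rewrite /m sum_trees_node; last by move=> T Tn; rewrite comm_coef_out ?scale0r.
  rewrite comm_coef_leaf // scale0r add0r.
  apply: tensor_image_sum => t1 _; apply: tensor_image_sum => t2 _.
  rewrite [leaves _]/= sum_words_cat scaler_sumr.
  apply: tensor_image_sum => w1; rewrite mem_words => /andP[/eqP s1 _].
  rewrite scaler_sumr; apply: tensor_image_sum => w2 _.
  rewrite scalerA tev_cat //; apply: tensor_imageZ; exact: tensor_image_ten.
have m0 : m = 0.
  apply: (coord_inj B_indep B_span) => b Bb; rewrite (lin0 (@coordL b)).
  rewrite (lin_sum (@coordL b)); have [bd|bd] := eqVneq (deg b) d.
    rewrite -[RHS](c_rel b Bb bd); apply: eq_bigr => T _.
    rewrite (linZ (@coordL b)) (lin_sum (@coordL b)); congr (_ * _).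
    apply: eq_big_seq => v; rewrite mem_words => /andP[/eqP sv vr].
    rewrite (linZ (@coordL b)) /cd; case: eqP => // vd.
    have [->|b0] := eqVneq (coord b (tev T v)) 0; first by rewrite scaler0 mulr0.
    case: vd; rewrite -bd; apply/esym; apply: (tev_graded sv _ Bb b0) => x /(allP vr).
    exact: rB.
  apply: big1 => T _; rewrite (linZ (@coordL b)) (lin_sum (@coordL b)).
  rewrite big1_seq ?scaler0 // => v /andP[_]; rewrite mem_words => /andP[/eqP sv vr].
  rewrite (linZ (@coordL b)) /cd; case: eqP => [vd|]; last by rewrite scale0r.
  have [->|b0] := eqVneq (coord b (tev T v)) 0; first by rewrite scaler0.
  case/eqP: bd; rewrite -vd; apply: (tev_graded sv _ Bb b0) => x /(allP vr); exact: rB.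
rewrite m0 in z_m; have [Y zY] := span_range (kernel_mul z_m).
have [r1 [r1_uniq r1B r01 cov]] := exists_cover B_indep B_span [seq q.2 | q <- Y] rB.
pose c1 (v : seq A) := (if all (mem r) v then cd v else 0) -
  (if size v == n then power_coef Y v else 0).
have sub_r1 v : all (mem r) v -> all (mem r1) v by apply: sub_all => x; apply: r01.
suff : c1 w = 0 by rewrite /c1 /cd wr wd eqxx ltn_eqF // subr0.
case: w wr w_gt1 wd wn => // a w' wr w_gt1 wd wn.
apply: (@outside_letters_vanish d setT r1 c1 _ _ r1_uniq r1B _ _ (a :: w')) => //.
- move=> T v b sv noC; have := leaves_gt0 T; rewrite -sv.
  by case: v noC {sv} => // x v noC _; have [_ []] := noC x (mem_head x v).
- move=> v v' vv'; rewrite /c1 (perm_all _ vv') (perm_size vv').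
  by rewrite /cd (perm_degw vv') (c_sym _ _ vv') (power_coef_sym Y vv').
- move=> e f Be Bf ef _.
  have : z (e, f) - (\sum_(q <- Y) q.1 *: top_product q.2) (e, f) = 0 by rewrite zY subrr.
  rewrite (@top_products_coef Y r1) => [<-|q qY]; last first.
    by apply: cov; apply: map_f.
  rewrite tens_coefB tens_coef_sub //; congr (_ - _).
  rewrite /z fct_sumE; apply: eq_bigr => t1 _; rewrite fct_sumE; apply: eq_bigr => t2 _.
  rewrite fct_sumE mulr_sumr; apply: eq_bigr => w1 _.
  rewrite fct_sumE mulr_sumr; apply: eq_bigr => w2 _.
  by rewrite scale_fctE mulrA.
- exact: sub_r1.
- by rewrite w_gt1 ltnW.
- exact: mem_head.
Qed.

End Core.

(** * Test algebras *)

(** Power series with coefficients in [A] belong to the same variety as [A]; mapping the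
    generators of a free algebra to their multiples by the indeterminate grades it. *)
Section PowerSeries.
Variables (K : fieldType) (A : naAlgType K).
Implicit Types f : nat -> A.

Definition conv f f' : nat -> A :=
  fun k => \sum_(j < k.+1) namul (f j) (f' (k - j)%N).

Lemma conv_linearl f' : linear (conv^~ f').
Proof.
move=> a f1 f2; apply/funext => k; rewrite /conv.
transitivity (\sum_(j < k.+1) (a *: namul (f1 j) (f' (k - j)%N) + namul (f2 j) (f' (k - j)%N))).
  by apply: eq_bigr => j _; rewrite -namulZl -namulDl.
by rewrite big_split -scaler_sumr.
Qed.

Lemma conv_linearr f : linear (conv f).
Proof.
move=> a f1 f2; apply/funext => k; rewrite /conv.
transitivity (\sum_(j < k.+1) (a *: namul (f j) (f1 (k - j)%N) + namul (f j) (f2 (k - j)%N))).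
  by apply: eq_bigr => j _; rewrite -namulZr -namulDr.
by rewrite big_split -scaler_sumr.
Qed.

Definition series_alg := nat -> A.
HB.instance Definition _ := GRing.Lmodule.on series_alg.
HB.instance Definition _ := Lmodule_isNonAssocAlg.Build K series_alg
  conv_linearl conv_linearr.

Lemma series_tpow T f N k : (k < N)%N -> (tpow T (f : series_alg) : nat -> A) k =
  \sum_(w <- words (iota 0 N) (leaves T) | degw id w == k) tev T (map f w).
Proof.
elim: T k => [|t1 IH1 t2 IH2] k kN.
  rewrite big_mkcond sum_words1 /= (bigD1_seq k) ?mem_iota ?iota_uniq //=.
  rewrite /degw /= addn0 eqxx big1 ?addr0 // => j jk.
  by rewrite addn0 (negPf jk).
rewrite [LHS]/= /conv big_mkcond [leaves _]/= sum_words_cat.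
transitivity (\sum_(j < k.+1) \sum_(w1 <- words (iota 0 N) (leaves t1))
    \sum_(w2 <- words (iota 0 N) (leaves t2))
   (if (degw id w1 == j) && (degw id w2 == (k - j)%N)
    then namul (tev t1 (map f w1)) (tev t2 (map f w2)) else 0)).
  apply: eq_bigr => j _; have jk : (j <= k)%N by rewrite -ltnS.
  rewrite IH1 ?(leq_ltn_trans jk) // IH2 ?(leq_ltn_trans (leq_subr _ _)) //.
  rewrite namul_suml big_mkcond; apply: eq_bigr => w1 _.
  case: eqP => _ /=; last by rewrite big1.
  by rewrite namul_sumr big_mkcond.
rewrite exchange_big; apply: eq_big_seq => w1; rewrite mem_words => /andP[/eqP s1 _].
rewrite exchange_big; apply: eq_bigr => w2 _.
rewrite map_cat tev_cat ?size_map // degw_cat.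
have [w12|w12] := eqVneq (degw id w1 + degw id w2)%N k.
  have w1k : (degw id w1 < k.+1)%N by rewrite ltnS -w12 leq_addr.
  have w2E : (k - degw id w1 = degw id w2)%N by rewrite -w12 addKn.
  rewrite (bigD1 (Ordinal w1k)) //= w2E !eqxx big1 ?addr0 // => j jn.
  by case: eqP => // e; case/eqP: jn; apply: val_inj; rewrite /= e.
rewrite big1 // => j _; case: eqP => // w1j; case: eqP => // w2j.
by case/eqP: w12; rewrite w1j w2j subnKC // -ltnS.
Qed.

(** The coefficient of order [k] of the identity at a power series is the component of
    weight [k] of the identity at its coefficients. *)
Lemma series_satisfies n g : [pchar K] =i pred0 -> satisfies n g A ->
  satisfies n g series_alg.
Proof.
move=> charK gA f; apply/funext => k.
rewrite -[RHS](@homogeneous_identity K charK n g A _ (iota 0 k.+1) f id (fun=> 1) k gA).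
have ev_lin : linear (fun h : series_alg => (h : nat -> A) k) by [].
rewrite [LHS](lin_sum ev_lin); apply: eq_bigr => T _.
rewrite -[LHS]/(g T *: (tpow T (f : series_alg) : nat -> A) k).
rewrite (@series_tpow T f k.+1) //; congr (_ *: _); apply: eq_bigr => w _.
by rewrite big1 // scale1r.
Qed.
End PowerSeries.

(** The square-zero extension by a line of an algebra [A] of the variety, with product
    twisted by a bilinear form [beta], satisfies the identity as soon as [beta] vanishes
    on the tensors [Phi(x)].  Through the universal property of a free algebra, such a
    form factors through the multiplication. *)
Section Extension.
Variables (K : fieldType) (A : naAlgType K) (beta : A -> A -> K^o).
Hypotheses (beta_l : forall y, linear (beta^~ y)) (beta_r : forall x, linear (beta x)).

Definition ext_mul (u v : A * K^o) : A * K^o := (namul u.1 v.1, beta u.1 v.1).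

Lemma ext_mul_l v : linear (ext_mul^~ v).
Proof.
by move=> a u1 u2; rewrite /ext_mul /= beta_l (@namul_linearl K A).
Qed.
Lemma ext_mul_r v : linear (ext_mul v).
Proof.
by move=> a u1 u2; rewrite /ext_mul /= beta_r (@namul_linearr K A).
Qed.

(** The linearity proofs are parameters so that the algebra structure can be attached
    canonically to the type. *)
Definition ext_alg of (forall y, linear (beta^~ y)) & (forall x, linear (beta x)) :=
  (A * K^o)%type.
Local Notation ext := (ext_alg beta_l beta_r).
HB.instance Definition _ := GRing.Lmodule.on ext.
HB.instance Definition _ := Lmodule_isNonAssocAlg.Build K ext ext_mul_l ext_mul_r.

Lemma ext_tpow_fst T (u : ext) : (tpow T u : A * K^o).1 = tpow T (u : A * K^o).1.
Proof. by elim: T => //= l -> r ->. Qed.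

Lemma ext_satisfies n g : (forall T, leaves T != n -> g T = 0) -> (1 < n)%N ->
  satisfies n g A ->
  (forall x, \sum_(l <- trees_height n) \sum_(r <- trees_height n)
     g (Node l r) *: beta (tpow l x) (tpow r x) = 0) ->
  satisfies n g ext.
Proof.
move=> g_supp n1 gA gbeta u; apply/eqP; rewrite -pair_eqE /=; apply/andP; split; apply/eqP.
  rewrite (raddf_sum fst) -[RHS](gA (u : A * K^o).1); apply: eq_bigr => T _.
  by rewrite /= ext_tpow_fst.
rewrite (raddf_sum snd) sum_trees_node => [|T Tn]; last first.
  by rewrite g_supp ?scale0r // gtn_eqF.
rewrite g_supp ?ltn_eqF // scale0r add0r -[RHS](gbeta (u : A * K^o).1).
apply: eq_bigr => l _; apply: eq_bigr => r _.
by rewrite /= !ext_tpow_fst.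
Qed.
End Extension.

(** * Free algebras *)

Lemma tensor_image_linear (K : fieldType) (A : naAlgType K) (B : set A)
    (phi : (A * A -> K^o) -> K^o) (theta : A -> K^o) :
  linear phi -> linear theta ->
  (forall x y, phi (ten B x y) = theta (namul x y)) ->
  forall z m, tensor_image B z m -> phi z = theta m.
Proof.
move=> pl tl H z m zm; rewrite -[z]/((z, m).1) -[m in RHS]/((z, m).2).
elim: zm => [|a u v [[x y] _ <-] _ IH] /=; first by rewrite (lin0 pl) (lin0 tl).
by rewrite pl tl H IH.
Qed.

Section FreeAlgebra.
Variables (K : fieldType) (charK : [pchar K] =i pred0) (n : nat) (g : bintree -> K).
Hypotheses (n_gt1 : (1 < n)%N) (g_supp : forall T, leaves T != n -> g T = 0).
Variables (A : naAlgType K) (X : Type) (gen : X -> A).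
Hypothesis A_free : free_on (satisfies n g) gen.

Let A_sat : satisfies n g A := A_free.1.

Lemma free_ext (B : naAlgType K) (h h' : A -> B) : satisfies n g B ->
  is_alg_hom h -> is_alg_hom h' -> (forall x, h (gen x) = h' (gen x)) -> h = h'.
Proof.
move=> sB hh hh' E; have [k [_ kU]] := A_free.2 B sB (h \o gen).
rewrite -(kU h) // -(kU h') //; split=> //.
by apply/funext => x; rewrite /= E.
Qed.

(** The generators generate: the subalgebra of elements satisfying [P] is in the variety,
    and the retraction onto it followed by the inclusion is the identity, by uniqueness. *)
Lemma free_ind (P : A -> Prop) : P 0 -> (forall a x y, P x -> P y -> P (a *: x + y)) ->
  (forall x y, P x -> P y -> P (namul x y)) -> (forall x, P (gen x)) -> forall x, P x.
Proof.
move=> P0 PL PM Pgen x.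
pose Q : subalgebra A := @Subalgebra K A P P0 PL PM.
have Q_sat : satisfies n g (subalg_type Q).
  move=> u; apply: val_inj.
  have vl : linear (val : subalg_type Q -> A) by exact: (subalg_valP (S := Q)).
  have vh : is_alg_hom (val : subalg_type Q -> A) by [].
  rewrite (lin0 vl) (lin_sum vl) -[RHS](A_sat (val u)); apply: eq_bigr => T _.
  by rewrite (linZ vl) (alg_hom_tpow vh).
have genQ y : gen y \in subalg_pred Q by apply/asboolP; apply: Pgen.
have [h [[[hl hm] hgen] _]] := A_free.2 _ Q_sat (fun y => SubalgElt (genQ y)).
have E : (fun y => val (h y)) = id.
  apply: free_ext => //.
    split=> [a u v|u v]; first by rewrite hl subalg_valP.
    by rewrite hm.
  by move=> y; rewrite -[h (gen y)]/((h \o gen) y) hgen.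
have /asboolP := valP (h x).
by rewrite -[val (h x)]/((fun y => val (h y)) x) E.
Qed.

(** ** Grading *)

(** The homomorphism to power series sends each element to the sequence of its
    homogeneous components. *)
Definition is_grading (delta : A -> nat -> A) := [/\
  linear (delta : A -> series_alg A), forall x y, delta (namul x y) = conv (delta x) (delta y)
  & forall x, delta (gen x) = fun k => if k == 1%N then gen x else 0].

Lemma grading_exists : exists delta, is_grading delta.
Proof.
have [h [[[hl hm] hgen] _]] := A_free.2 _ (series_satisfies charK A_sat)
  (fun x => (fun k => if k == 1%N then gen x else 0) : series_alg A).
exists h; split=> // x.
by rewrite -[h (gen x)]/((h \o gen) x) hgen.
Qed.

Variable delta : A -> nat -> A.
Hypothesis delta_grading : is_grading delta.

Lemma delta_lin k : linear (delta^~ k).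
Proof. by case: delta_grading => dl _ _ a x y; rewrite dl. Qed.

Lemma deltaM x y k : delta (namul x y) k =
  \sum_(j < k.+1) namul (delta x j) (delta y (k - j)%N).
Proof. by case: delta_grading => _ -> _. Qed.

Definition is_homog k x := forall j, delta x j = if j == k then x else 0.

Lemma homog_gen x : is_homog 1 (gen x).
Proof. by move=> j; case: delta_grading => _ _ ->. Qed.

Lemma homog0 k : is_homog k 0.
Proof. by move=> j; rewrite (lin0 (delta_lin j)) if_same. Qed.

Lemma homogP k a x y : is_homog k x -> is_homog k y -> is_homog k (a *: x + y).
Proof.
move=> hx hy j; rewrite (delta_lin j) hx hy; case: eqP => // _.
by rewrite scaler0 addr0.
Qed.

Lemma homogM p q x y : is_homog p x -> is_homog q y -> is_homog (p + q) (namul x y).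
Proof.
move=> hx hy k; rewrite deltaM.
have [->|kpq] := eqVneq k (p + q)%N.
  have pk : (p < (p + q).+1)%N by rewrite ltnS leq_addr.
  rewrite (bigD1 (Ordinal pk)) //= hx hy eqxx addKn eqxx big1 ?addr0 // => j jp.
  by rewrite hx ifN ?namul0l //; apply: contraNneq jp => e; apply/eqP/val_inj.
rewrite big1 // => j _; rewrite hx hy.
have [jp|_] := eqVneq (j : nat) p; last by rewrite namul0l.
have [kj|_] := eqVneq (k - j)%N q; last by rewrite namul0r.
by case/eqP: kpq; rewrite -jp -kj subnKC // -ltnS.
Qed.

Lemma homog_uniq p q x : x != 0 -> is_homog p x -> is_homog q x -> p = q.
Proof.
by move=> x0 /(_ q) Hp /(_ q); rewrite Hp eqxx; case: eqP => // _ /esym/eqP; rewrite (negPf x0).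
Qed.

Definition homogeneous : set A := fun x => exists k, is_homog k x.

(** The span of the homogeneous elements is closed under products and contains the
    generators. *)
Lemma homogeneous_span x : span homogeneous x.
Proof.
move: x; apply: free_ind.
- exact: span0.
- by move=> a x y; apply: spanP.
- move=> x y Hx Hy; move: x Hx; apply: span_min.
  + by rewrite namul0l; apply: span0.
  + by move=> a x1 x2 H1 H2; rewrite namulDl namulZl; apply: spanP.
  + move=> x [p hx]; move: y Hy; apply: span_min.
    * by rewrite namul0r; apply: span0.
    * by move=> a y1 y2 H1 H2; rewrite namulDr namulZr; apply: spanP.
    * by move=> y [q hy]; apply: mem_span; exists (p + q)%N; apply: homogM.
- by move=> x; apply: mem_span; exists 1%N; apply: homog_gen.
Qed.

Lemma homog_delta k x : is_homog k (delta x k).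
Proof.
have := homogeneous_span x; move: x; apply: span_min.
- by rewrite (lin0 (delta_lin k)); apply: homog0.
- by move=> a x y Hx Hy; rewrite (delta_lin k); apply: homogP.
- by move=> x [p hx]; rewrite hx; case: eqP => [->//|_]; apply: homog0.
Qed.

Lemma delta0 x : delta x 0 = 0.
Proof.
move: x; apply: free_ind.
- exact: (lin0 (delta_lin 0)).
- by move=> a x y Hx Hy; rewrite (delta_lin 0) Hx Hy scaler0 addr0.
- by move=> x y Hx Hy; rewrite deltaM big_ord_recl big_ord0 Hx namul0l addr0.
- by move=> x; rewrite homog_gen.
Qed.

Lemma homog_gt0 k x : x != 0 -> is_homog k x -> (0 < k)%N.
Proof. by move=> x0; case: k => // /(_ 0%N) /=; rewrite delta0 => /esym/eqP; rewrite (negPf x0). Qed.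

Lemma delta_sum x : exists N, forall M, (N <= M)%N -> x = \sum_(k < M) delta x k.
Proof.
have := homogeneous_span x; move: x; apply: span_min.
- by exists 0%N => M _; rewrite big1 // => k _; apply: (lin0 (delta_lin k)).
- move=> a x y [N HN] [N' HN']; exists (maxn N N') => M.
  rewrite geq_max => /andP[NM N'M]; rewrite {1}(HN _ NM) {1}(HN' _ N'M) scaler_sumr.
  by rewrite -big_split; apply: eq_bigr => k _; rewrite (delta_lin k).
- move=> x [k hx]; exists k.+1 => M kM.
  rewrite (bigD1 (Ordinal kM)) //= hx eqxx big1 ?addr0 // => j jk.
  by rewrite hx ifN //; apply: contraNneq jk => e; apply/eqP/val_inj.
Qed.

Lemma delta_eq0 x : (forall k, delta x k = 0) -> x = 0.
Proof. by have [N HN] := delta_sum x => H; rewrite (HN N) // big1. Qed.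

Definition deg_lt k x := forall j, (k <= j)%N -> delta x j = 0.

Lemma deg_ltP k a x y : deg_lt k x -> deg_lt k y -> deg_lt k (a *: x + y).
Proof.
by move=> hx hy j kj; rewrite (delta_lin j) hx // hy // scaler0 addr0.
Qed.

Lemma deg_lt0 k : deg_lt k 0.
Proof. by move=> j _; apply: (lin0 (delta_lin j)). Qed.

Lemma deg_lt_mono k k' x : (k <= k')%N -> deg_lt k x -> deg_lt k' x.
Proof. by move=> kk' hx j k'j; apply: hx; apply: leq_trans k'j. Qed.

Lemma deg_lt1 x : deg_lt 1 x -> x = 0.
Proof. by move=> hx; apply: delta_eq0 => -[|k]; [apply: delta0|apply: hx]. Qed.

Lemma deg_lt_top k x : deg_lt k.+1 x -> delta x k = 0 -> deg_lt k x.
Proof.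
by move=> hx xk j; rewrite leq_eqVlt => /orP[/eqP <- //|]; apply: hx.
Qed.

Lemma deg_lt_exists x : exists k, deg_lt k x.
Proof.
have := homogeneous_span x; move: x; apply: span_min.
- by exists 0%N; apply: deg_lt0.
- move=> a x y [p hx] [q hy]; exists (maxn p q).
  by apply: deg_ltP; [apply: deg_lt_mono hx|apply: deg_lt_mono hy];
    rewrite ?leq_maxl ?leq_maxr.
- by move=> x [k hx]; exists k.+1 => j kj; rewrite hx gtn_eqF.
Qed.

Lemma delta_topM p q x y : deg_lt p.+1 x -> deg_lt q.+1 y ->
  deg_lt (p + q).+1 (namul x y) /\ delta (namul x y) (p + q) = namul (delta x p) (delta y q).
Proof.
move=> hx hy; split.
  move=> k kpq; rewrite deltaM big1 // => j _.
  have [pj|jp] := ltnP p j; first by rewrite hx ?namul0l.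
  rewrite hy ?namul0r // ltn_subRL; apply: leq_ltn_trans kpq.
  by rewrite leq_add2r.
rewrite deltaM.
have pk : (p < (p + q).+1)%N by rewrite ltnS leq_addr.
rewrite (bigD1 (Ordinal pk)) //= addKn big1 ?addr0 // => j jp.
have [pj|jp'] := ltnP p j; first by rewrite hx ?namul0l.
rewrite hy ?namul0r // ltn_subRL ltn_add2r ltn_neqAle jp' andbT.
by apply: contraNneq jp => e; apply/eqP/val_inj.
Qed.

(** ** The kernel of the multiplication *)

Section HomogeneousBasis.
Variable B : set A.
Hypotheses (B_indep : indep B) (B_span : forall x, span B x).

(** If [z] were not in the span, a linear form on [A (x) A] would separate it from all
    [Phi(x)].  The corresponding square-zero extension is in the variety, and the
    homomorphism from [A] to it shows that the form factors through the multiplication,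
    so it vanishes at [z]. *)
Lemma free_kernel_mul z : tensor_image B z 0 -> span (range (top_product n g B)) z.
Proof.
move=> z0; apply: contrapT => zP.
have [||phi [pl pP pz]] := separation _ _ zP.
- exact: span0.
- by move=> *; apply: spanP.
pose beta (x y : A) : K^o := phi (ten B x y).
have tl y : linear (fun x => ten B x y).
  move=> a x x'; apply/funext => -[b b']; rewrite /ten /= (coord_lin B_indep B_span).
  by rewrite mulrDl -mulrA.
have tr x : linear (ten B x).
  move=> a y y'; apply/funext => -[b b']; rewrite /ten /= (coord_lin B_indep B_span).
  by rewrite mulrDr mulrCA.
have beta_l y : linear (beta^~ y) by move=> a x x'; rewrite /beta (tl y) pl.
have beta_r x : linear (beta x) by move=> a y y'; rewrite /beta (tr x) pl.
have ext_sat : satisfies n g (ext_alg beta_l beta_r).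
  apply: ext_satisfies => // x.
  rewrite -[RHS](pP (top_product n g B x)); last by apply: mem_span; exists x.
  rewrite (lin_sum pl); apply: eq_bigr => l _.
  by rewrite (lin_sum pl); apply: eq_bigr => r _; rewrite (linZ pl).
have [h [[[hl hm] hgen] _]] := A_free.2 _ ext_sat (fun x => (gen x, 0) : ext_alg beta_l beta_r).
have E : (fun x => (h x : A * K^o).1) = id.
  apply: free_ext => //.
    by split=> [a u v|u v]; rewrite ?hl ?hm.
  by move=> y; rewrite -[h (gen y)]/((h \o gen) y) hgen.
have h1 x : (h x : A * K^o).1 = x by exact: (congr1 (fun f => f x) E).
pose theta x : K^o := (h x : A * K^o).2.
have tl' : linear theta by move=> a u v; rewrite /theta hl.
have tM x y : phi (ten B x y) = theta (namul x y) by rewrite /theta hm /= !h1.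
have := tensor_image_linear pl tl' tM z0.
by rewrite (lin0 tl') pz => /eqP; rewrite oner_eq0.
Qed.

Hypothesis B_homog : forall b, B b -> homogeneous b.

Definition deg (b : A) : nat := xget 0%N (fun k => is_homog k b).

Lemma homog_deg b : B b -> is_homog (deg b) b.
Proof. by move=> /B_homog[k hk]; exact: (@xgetI _ 0%N (fun k => is_homog k b) k hk). Qed.

Lemma basis_deg_gt0 b : B b -> (0 < deg b)%N.
Proof. by move=> Bb; apply: (homog_gt0 (indep_neq0 B_indep Bb)); apply: homog_deg. Qed.

Lemma degE b k : B b -> is_homog k b -> deg b = k.
Proof.
by move=> Bb hk; apply: homog_uniq hk; [apply: indep_neq0 Bb|apply: homog_deg].
Qed.

Lemma coord_delta a x : B a -> coord B a x = coord B a (delta x (deg a)).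
Proof.
move=> Ba; have := B_span x; move: x; apply: span_min.
- by rewrite (lin0 (delta_lin _)).
- move=> c x y Hx Hy; rewrite (delta_lin (deg a)) !(coord_lin B_indep B_span).
  by rewrite Hx Hy.
- move=> b Bb; rewrite (homog_deg Bb); case: eqVneq => // ab.
  rewrite (lin0 (coord_lin B_indep B_span a)) (coord_basis B_indep B_span _ Bb).
  by case: eqP => // e; rewrite e eqxx in ab.
Qed.

Lemma coord_homog a k x : B a -> is_homog k x -> deg a != k -> coord B a x = 0.
Proof.
move=> Ba hx ak; rewrite coord_delta // hx (negPf ak).
exact: (lin0 (coord_lin B_indep B_span a)).
Qed.

Lemma homog_tev T w : size w = leaves T -> (forall x, x \in w -> B x) ->
  is_homog (degw deg w) (tev T w).
Proof.
elim: T w => [|l IHl r IHr] w.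
  case: w => [|x [|]] //= _ H; rewrite /degw /= addn0; apply: homog_deg.
  by apply: H; rewrite mem_head.
move=> sw wB; rewrite -(cat_take_drop (leaves l) w) degw_cat.
have sl : size (take (leaves l) w) = leaves l.
  by rewrite size_takel // sw /= leq_addr.
rewrite tev_cat //; apply: homogM.
  by apply: IHl => // x /mem_take; apply: wB.
apply: IHr; first by rewrite size_drop sw /= addKn.
by move=> x /mem_drop; apply: wB.
Qed.

Lemma coord_tev_graded T w a : size w = leaves T -> (forall x, x \in w -> B x) ->
  B a -> coord B a (tev T w) != 0 -> deg a = degw deg w.
Proof.
move=> sw wB Ba; apply: contraNeq => aw.
by rewrite (coord_homog Ba (homog_tev sw wB)).
Qed.

End HomogeneousBasis.

(** * Subalgebras of a free algebra *)

Section Subalgebra.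
Local Open Scope classical_set_scope.
Local Open Scope ring_scope.
Hypothesis g_generic : comm_coef n g (Node Leaf Leaf) != 0.
Variables (S : naAlgType K) (iota : S -> A).
Hypotheses (iota_hom : is_alg_hom iota) (iota_inj : injective iota).

Let iota_lin : linear iota := iota_hom.1.
Let iotaM x y : iota (namul x y) = namul (iota x) (iota y). Proof. exact: iota_hom.2. Qed.

Lemma sub_sat : satisfies n g S.
Proof.
move=> x; apply: iota_inj; rewrite (lin0 iota_lin) (lin_sum iota_lin).
rewrite -[RHS](A_sat (iota x)); apply: eq_bigr => T _.
by rewrite (linZ iota_lin) (alg_hom_tpow iota_hom).
Qed.

(** The filtration of [S] by degree in [A]; the bound is strict, so that [filt k.+1] is
    the part on which the leading component of degree [k] is defined. *)
Definition filt k s := deg_lt k (iota s).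
Definition lead k s := delta (iota s) k.

Lemma lead_lin k : linear (lead k).
Proof. by move=> a x y; rewrite /lead iota_lin (delta_lin k). Qed.

Lemma filtP k a x y : filt k x -> filt k y -> filt k (a *: x + y).
Proof. by rewrite /filt iota_lin; apply: deg_ltP. Qed.

Lemma filt0 k : filt k 0.
Proof. by rewrite /filt (lin0 iota_lin); apply: deg_lt0. Qed.

Lemma filtZ k a x : filt k x -> filt k (a *: x).
Proof. by move=> hx; rewrite -[_ *: _]addr0; apply: filtP => //; apply: filt0. Qed.

Lemma filtB k x y : filt k x -> filt k y -> filt k (x - y).
Proof. by move=> hx hy; rewrite addrC -scaleN1r; apply: filtP. Qed.

Lemma filt_sum k (I : eqType) (r : seq I) (E : I -> S) :
  (forall i, i \in r -> filt k (E i)) -> filt k (\sum_(i <- r) E i).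
Proof.
move=> H; rewrite big_seq; apply: (big_ind (filt k)) => //; first exact: filt0.
by move=> x y hx hy; rewrite -[x]scale1r; apply: filtP.
Qed.

Lemma filt_mono k k' x : (k <= k')%N -> filt k x -> filt k' x.
Proof. exact: deg_lt_mono. Qed.

Lemma filt1 x : filt 1 x -> x = 0.
Proof. by move=> /deg_lt1 x0; apply: iota_inj; rewrite x0 (lin0 iota_lin). Qed.

Lemma filt_top k x : filt k.+1 x -> lead k x = 0 -> filt k x.
Proof. exact: deg_lt_top. Qed.

Lemma lead_filt k x : filt k x -> lead k x = 0.
Proof. by move=> /(_ k); apply. Qed.

Lemma filt_exists x : exists k, filt k x.
Proof. exact: deg_lt_exists. Qed.

Lemma filtM p q x y : filt p.+1 x -> filt q.+1 y -> filt (p + q).+1 (namul x y).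
Proof. by move=> hx hy; rewrite /filt iotaM; case: (delta_topM hx hy). Qed.

Lemma leadM p q x y : filt p.+1 x -> filt q.+1 y ->
  lead (p + q) (namul x y) = namul (lead p x) (lead q y).
Proof. by move=> hx hy; rewrite /lead iotaM; case: (delta_topM hx hy). Qed.

(** The components of degree [k] of the graded subalgebra of leading components. *)
Definition grS k : set A := [set a | exists2 s, filt k.+1 s & lead k s = a].

Lemma grS_homog k a : grS k a -> is_homog k a.
Proof. by move=> [s _ <-]; apply: homog_delta. Qed.

Lemma grSM p q a b : grS p a -> grS q b -> grS (p + q) (namul a b).
Proof.
move=> [x hx <-] [y hy <-]; exists (namul x y); first exact: filtM.
exact: leadM.
Qed.

Definition gr_all : set A := [set a | exists k, grS k a].
(** Products in this graded subalgebra; a basis of a complement of their span will be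
    lifted to free generators of [S]. *)
Definition gr_dec : set A :=
  [set a | exists p q x y, [/\ grS p x, grS q y & a = namul x y]].

(** Three nested bases, of the decomposable part of the graded subalgebra, of the graded
    subalgebra, and of [A]. *)
Lemma adapted_basis : exists B0 B1 B : set A,
  [/\ [/\ B0 `<=` B1, B1 `<=` B & B0 `<=` gr_dec], [/\ B1 `<=` gr_all & B `<=` homogeneous],
     indep B & [/\ forall x, gr_dec x -> span B0 x, forall x, gr_all x -> span B1 x
        & forall x, span B x]].
Proof.
have dec_all : gr_dec `<=` gr_all.
  by move=> _ [p [q [x [y [hx hy ->]]]]]; exists (p + q)%N; apply: grSM.
have all_homog : gr_all `<=` homogeneous by move=> a [k /grS_homog hk]; exists k.
have [//|B0 [_ B0G B0i B0s]] := @basis_extend K A set0 gr_dec (@indep0 K A).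
have [|B1 [B01 B1G B1i B1s]] := basis_extend B0i (_ : B0 `<=` gr_all).
  by move=> x /B0G /dec_all.
have [|B [B1B BG Bi Bs]] := basis_extend B1i (_ : B1 `<=` homogeneous).
  by move=> x /B1G /all_homog.
exists B0, B1, B; split=> //; split=> // x.
by apply: sub_span (homogeneous_span x).
Qed.

Variables B0 B1 B : set A.
Hypotheses (B01 : B0 `<=` B1) (B1B : B1 `<=` B) (B0_dec : B0 `<=` gr_dec)
  (B1_gr : B1 `<=` gr_all) (B_homog : B `<=` homogeneous) (B_indep : indep B)
  (B0_span : forall x, gr_dec x -> span B0 x) (B1_span : forall x, gr_all x -> span B1 x)
  (B_span : forall x, span B x).
Local Notation coord := (coord B).
Let coordL b : linear (coord b : A -> K^o) := @coord_lin K A B B_indep B_span b.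

Lemma B1_grS b : B1 b -> grS (deg b) b.
Proof.
move=> B1b; have [k kb] := B1_gr B1b.
by rewrite (degE B_indep B_homog (B1B B1b) (grS_homog kb)).
Qed.

Lemma lift_exists : exists ell : A -> S,
  forall b, B1 b -> filt (deg b).+1 (ell b) /\ lead (deg b) (ell b) = b.
Proof.
have /choice[ell H] b : exists s, B1 b -> filt (deg b).+1 s /\ lead (deg b) s = b.
  have [B1b|nB1b] := pselect (B1 b); last by exists 0.
  by have [s] := B1_grS B1b; exists s.
by exists ell.
Qed.

Variable ell : A -> S.
Hypotheses (ell_filt : forall b, B1 b -> filt (deg b).+1 (ell b))
  (ell_lead : forall b, B1 b -> lead (deg b) (ell b) = b).

Lemma coord_gr b k a : ~ B1 b -> grS k a -> coord b a = 0.
Proof.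
move=> nb ka; apply: (coord_eq0 B_indep B_span B1B nb).
by apply: B1_span; exists k.
Qed.

Lemma coord_gr_deg b k a : coord b a != 0 -> grS k a -> B1 b /\ deg b = k.
Proof.
move=> ba ka; have [B1b|nB1b] := pselect (B1 b).
  split=> //; apply/eqP; apply: contraNT ba => bk.
  by rewrite (coord_homog B_indep B_span B_homog (B1B B1b) (grS_homog ka)).
by case/eqP: ba; apply: coord_gr ka.
Qed.

(** Lifting letters commutes with monomials up to terms of lower degree. *)
Lemma tev_ell T w : size w = leaves T -> (forall x, x \in w -> B1 x) ->
  filt (degw deg w).+1 (tev T (map ell w)) /\ lead (degw deg w) (tev T (map ell w)) = tev T w.
Proof.
elim: T w => [|l IHl r IHr] w.
  case: w => [|x [|]] //= _ H; rewrite /degw /= addn0.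
  by split; [apply: ell_filt|apply: ell_lead]; apply: H; rewrite mem_head.
move=> sw wB; rewrite -(cat_take_drop (leaves l) w) degw_cat map_cat.
have sl : size (take (leaves l) w) = leaves l by rewrite size_takel // sw /= leq_addr.
have sr : size (drop (leaves l) w) = leaves r by rewrite size_drop sw /= addKn.
have [|fl dl] := IHl _ sl; first by move=> x /mem_take; apply: wB.
have [|fr dr] := IHr _ sr; first by move=> x /mem_drop; apply: wB.
rewrite !tev_cat ?size_map //; split; first exact: filtM.
by rewrite leadM // dl dr.
Qed.

(** ** Partial homomorphisms *)

Section PartialHom.
Variables (C : naAlgType K) (C_sat : satisfies n g C).

Definition hom_below k (h : S -> C) := forall p q x y,
  filt p.+1 x -> filt q.+1 y -> (p + q < k)%N -> h (namul x y) = namul (h x) (h y).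

Variables (k : nat) (h : S -> C).
Hypotheses (h_lin : linear h) (h_hom : hom_below k h).

(** The defect of multiplicativity of [h].  It vanishes in total degree less than [k], so
    in total degree [k] it only depends on leading components. *)
Let beta x y := namul (h x) (h y) - h (namul x y).

Let beta_l y : linear (beta^~ y).
Proof.
move=> a x x'; rewrite /beta h_lin !namulDl !namulZl h_lin scalerBr.
by rewrite opprD addrACA.
Qed.

Let beta_r x : linear (beta x).
Proof.
move=> a y y'; rewrite /beta h_lin !namulDr !namulZr h_lin scalerBr.
by rewrite opprD addrACA.
Qed.

Let beta0 p q x y : filt p x -> filt q y -> (p + q <= k.+1)%N -> beta x y = 0.
Proof.
case: p => [|p] fx fy pq.
  by rewrite (filt1 (filt_mono (leq0n 1) fx)) (lin0 (beta_l y)).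
case: q fy pq => [|q] fy pq.
  by rewrite (filt1 (filt_mono (leq0n 1) fy)) (lin0 (beta_r x)).
rewrite /beta (h_hom fx fy) ?subrr //.
by move: pq; rewrite addSn addnS !ltnS.
Qed.

(** The bilinear form induced by [beta] in degree [k] on the graded subalgebra. *)
Let beta' b b' := if (deg b + deg b')%N == k then beta (ell b) (ell b') else 0.

Let beta_lead r p q x y : (forall b, b \in r -> B b) -> filt p.+1 x -> filt q.+1 y ->
  (p + q)%N = k -> covers B r (lead p x) -> covers B r (lead q y) ->
  beta x y = \sum_(b <- r) \sum_(b' <- r)
    (coord b (lead p x) * coord b' (lead q y)) *: beta' b b'.
Proof.
move=> rB fx fy pq cx cy.
have approx m u : filt m.+1 u -> covers B r (lead m u) ->
    let u' := \sum_(b <- r) coord b (lead m u) *: ell b in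
    filt m.+1 u' /\ filt m (u - u').
  move=> fu cu /=; set u' := \sum_(b <- r) _.
  have gu : grS m (lead m u) by exists u.
  have fu' : filt m.+1 u'.
    apply: filt_sum => b _; have [->|b0] := eqVneq (coord b (lead m u)) 0.
      by rewrite scale0r; apply: filt0.
    by have [B1b <-] := coord_gr_deg b0 gu; apply/filtZ/ell_filt.
  split=> //; apply: filt_top; first exact: filtB.
  rewrite (linB (lead_lin m)) (lin_sum (lead_lin m)) {1}cu -sumrB big1 // => b _.
  rewrite (linZ (lead_lin m)) -scalerBr.
  have [->|b0] := eqVneq (coord b (lead m u)) 0; first by rewrite scale0r.
  by have [B1b bm] := coord_gr_deg b0 gu; rewrite -bm (ell_lead B1b) subrr scaler0.
have [fx' dx] := approx p x fx cx; have [fy' dy] := approx q y fy cy.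
set x' := \sum_(b <- r) _ in fx' dx; set y' := \sum_(b <- r) _ in fy' dy.
have -> : beta x y = beta x' y'.
  apply/eqP; rewrite -subr_eq0; apply/eqP.
  have -> : beta x y - beta x' y' = beta (x - x') y + beta x' (y - y').
    by rewrite (linB (beta_l _)) (linB (beta_r _)) addrA subrK.
  rewrite (beta0 dx fy) ?addnS ?pq // (beta0 fx' dy) ?addSn ?pq // addr0 //.
rewrite (lin_sum (beta_l _)); apply: eq_bigr => b _.
rewrite (linZ (beta_l _)) (lin_sum (beta_r _)) scaler_sumr; apply: eq_bigr => b' _.
rewrite (linZ (beta_r _)) scalerA.
have [->|b0] := eqVneq (coord b (lead p x)) 0; first by rewrite mul0r !scale0r.
have [->|b'0] := eqVneq (coord b' (lead q y)) 0; first by rewrite mulr0 !scale0r.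
have [_ bp] : B1 b /\ deg b = p by apply: coord_gr_deg b0 _; exists x.
have [_ b'q] : B1 b' /\ deg b' = q by apply: coord_gr_deg b'0 _; exists y.
by rewrite /beta' bp b'q pq eqxx.
Qed.

Let h_tev T w : size w = leaves T -> (forall x, x \in w -> B1 x) -> (degw deg w < k)%N ->
  h (tev T (map ell w)) = tev T (map (h \o ell) w).
Proof.
elim: T w => [|l IHl r IHr] w; first by case: w.
move=> sw wB wk.
have sl : size (take (leaves l) w) = leaves l by rewrite size_takel // sw /= leq_addr.
have sr : size (drop (leaves l) w) = leaves r by rewrite size_drop sw /= addKn.
have lB x : x \in take (leaves l) w -> B1 x by move=> /mem_take; apply: wB.
have rB x : x \in drop (leaves l) w -> B1 x by move=> /mem_drop; apply: wB.
move: wk; rewrite -(cat_take_drop (leaves l) w) degw_cat !map_cat => wk.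
rewrite !tev_cat ?size_map //.
have [fl _] := tev_ell sl lB; have [fr _] := tev_ell sr rB.
rewrite (h_hom fl fr wk) IHl ?IHr //.
  by apply: leq_ltn_trans wk; rewrite leq_addl.
by apply: leq_ltn_trans wk; rewrite leq_addr.
Qed.

(** This is the compatibility needed to extend [h] to products of total degree [k].  The
    leading parts of the pairs in [Z] form a tensor [zt] in the kernel of the
    multiplication of [A], hence a combination of tensors [Phi(x)].  Since [zt] has no
    coordinate outside the subalgebra, the contraction argument shows that the symmetric
    tensor [c] behind it only involves letters of [B1].  These letters lift to [S], and
    the defect of [h] on [zt] becomes a combination of values of the identity in [C] and
    of images under [h] of values of the identity in [S]. *)
Lemma obstruction_vanishes (Z : seq (nat * nat * (S * S))) :
  (forall z, z \in Z -> [/\ (z.1.1 + z.1.2)%N = k, filt z.1.1.+1 z.2.1 & filt z.1.2.+1 z.2.2]) ->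
  filt k (\sum_(z <- Z) namul z.2.1 z.2.2) ->
  \sum_(z <- Z) namul (h z.2.1) (h z.2.2) = h (\sum_(z <- Z) namul z.2.1 z.2.2).
Proof.
move=> ZP Zk; apply/eqP; rewrite -subr_eq0 (lin_sum h_lin) -sumrB; apply/eqP.
pose zt : A * A -> K^o := \sum_(z <- Z) ten B (lead z.1.1 z.2.1) (lead z.1.2 z.2.2).
have zt0 : tensor_image B zt 0.
  rewrite -(lead_filt Zk) (lin_sum (lead_lin k)).
  apply: tensor_image_sum => z zZ; have [zk fx fy] := ZP z zZ.
  by rewrite -zk leadM //; apply: tensor_image_ten.
have [Y ztY] := span_range (free_kernel_mul B_indep B_span zt0).
have [|r1 [r1_uniq r1B _ cov1]] := @exists_cover _ _ _ B_indep B_span [seq q.2 | q <- Y] [::].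
  by [].
pose L := [seq lead z.1.1 z.2.1 | z <- Z] ++ [seq lead z.1.2 z.2.2 | z <- Z] ++
  [seq tev T w | T <- trees_height n, w <- words r1 (leaves T)].
have [r2 [r2_uniq r2B _ cov2]] := exists_cover B_indep B_span L r1B.
pose c w := if size w == n then power_coef B Y w else 0.
have zt_coef a b : zt (a, b) = tens_coef n g B r1 c a b.
  rewrite ztY (top_products_coef g_supp B_indep B_span (r := r1)) // => q qY.
  by apply: cov1; apply: map_f.
have c0 w a : all (mem r1) w -> (1 < size w <= n)%N -> degw deg w = k -> a \in w ->
    ~ B1 a -> c w = 0.
  move=> wr wn wk aw nB1a.
  have main := @outside_letters_vanish K A n g n_gt1 g_generic B deg B_indep B_span
   (basis_deg_gt0 B_indep B_homog) (coord_tev_graded B_indep B_span B_homog) k (~` B1) r1 c.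
  apply: (main _ _ r1_uniq r1B _ _ w wr wn wk a aw nB1a).
  - move=> d' _; apply: (comm_injective_all n_gt1 g_supp g_generic B_indep B_span).
    + exact: basis_deg_gt0.
    + exact: coord_tev_graded.
    + exact: free_kernel_mul.
  - move=> T v b sv vB Bb nB1b.
    have vB1 x : x \in v -> B1 x.
      by move=> /vB[_ xB1]; apply: contrapT.
    have [ft dt] := tev_ell sv vB1.
    by apply: (@coord_gr b (degw deg v)) => //; exists (tev T (map ell v)).
  - by move=> v v' vv'; rewrite /c (perm_size vv') (power_coef_sym B Y vv').
  - move=> a' b _ _ _ ab; rewrite -zt_coef /zt fct_sumE big1_seq // => z /andP[_ zZ].
    have [zk fx fy] := ZP z zZ; rewrite /ten /=.
    case: ab => nb; [rewrite (@coord_gr a' z.1.1) ?mul0r //|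
                     rewrite (@coord_gr b z.1.2) ?mulr0 //].
      by exists z.2.1.
    by exists z.2.2.
have covT T w : T \in trees_height n -> w \in words r1 (leaves T) -> covers B r2 (tev T w).
  by move=> Tn wT; apply: cov2; rewrite !mem_cat; apply/orP; right; apply/orP; right;
    apply/allpairsPdep; exists T, w.
(* [Lb] evaluates the induced bilinear form on a tensor; both sides are compared as
   values of this linear map. *)
pose Lb (E : A * A -> K^o) : C := \sum_(b <- r2) \sum_(b' <- r2) (E (b, b') : K) *: beta' b b'.
have Lb_lin : linear Lb.
  move=> a E E'; rewrite /Lb scaler_sumr -big_split; apply: eq_bigr => b _.
  rewrite scaler_sumr -big_split; apply: eq_bigr => b' _.
  by rewrite /= scalerA -scalerDl.
have -> : \sum_(z <- Z) (namul (h z.2.1) (h z.2.2) - h (namul z.2.1 z.2.2)) = Lb zt.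
  rewrite (lin_sum Lb_lin); apply: eq_big_seq => z zZ; have [zk fx fy] := ZP z zZ.
  rewrite -[LHS]/(beta z.2.1 z.2.2) (beta_lead r2B fx fy zk) //; apply: cov2; rewrite /L !mem_cat.
    by rewrite (map_f (fun z => lead z.1.1 z.2.1) zZ).
  by rewrite (map_f (fun z => lead z.1.2 z.2.2) zZ) orbT.
pose D T w := tev T (map (h \o ell) w) - h (tev T (map ell w)).
have -> : zt = \sum_(t1 <- trees_height n) \sum_(t2 <- trees_height n)
    comm_coef n g (Node t1 t2) *: \sum_(w1 <- words r1 (leaves t1))
    \sum_(w2 <- words r1 (leaves t2)) c (w1 ++ w2) *: ten B (tev t1 w1) (tev t2 w2).
  apply/funext => -[a b]; rewrite zt_coef /tens_coef fct_sumE; apply: eq_bigr => t1 _.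
  rewrite fct_sumE; apply: eq_bigr => t2 _; rewrite scale_fctE fct_sumE; congr (_ * _).
  apply: eq_bigr => w1 _; rewrite fct_sumE; apply: eq_bigr => w2 _.
  by rewrite scale_fctE.
have LbD t1 t2 w1 w2 : t1 \in trees_height n -> t2 \in trees_height n ->
    w1 \in words r1 (leaves t1) -> w2 \in words r1 (leaves t2) ->
    c (w1 ++ w2) *: Lb (ten B (tev t1 w1) (tev t2 w2)) =
    if degw deg (w1 ++ w2) == k then c (w1 ++ w2) *: D (Node t1 t2) (w1 ++ w2) else 0.
  move=> t1n t2n w1r w2r.
  have cv1 := covT _ _ t1n w1r; have cv2 := covT _ _ t2n w2r.
  move: w1r w2r; rewrite !mem_words => /andP[/eqP s1 w1r] /andP[/eqP s2 w2r].
  have w1B x : x \in w1 -> B x by move=> /(allP w1r); apply: r1B.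
  have w2B x : x \in w2 -> B x by move=> /(allP w2r); apply: r1B.
  have h1 := homog_tev B_homog s1 w1B; have h2 := homog_tev B_homog s2 w2B.
  case: eqP => [wk|wk]; last first.
    rewrite /Lb big1_seq ?scaler0 // => b /andP[_ br]; rewrite big1_seq // => b' /andP[_ b'r].
    rewrite /beta' /ten /=; case: eqP => bk; last by rewrite scaler0.
    have [b1|b1] := eqVneq (deg b) (degw deg w1); last first.
      by rewrite (coord_homog B_indep B_span B_homog (r2B b br) h1 b1) mul0r scale0r.
    have [b2|b2] := eqVneq (deg b') (degw deg w2); last first.
      by rewrite (coord_homog B_indep B_span B_homog (r2B b' b'r) h2 b2) mulr0 scale0r.
    by case: wk; rewrite degw_cat -b1 -b2.
  have [[a aw nB1a]|allB1] := pselect (exists2 a, a \in w1 ++ w2 & ~ B1 a).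
    suff -> : c (w1 ++ w2) = 0 by rewrite !scale0r.
    have [sw|sw] := eqVneq (size (w1 ++ w2)) n; last by rewrite /c (negPf sw).
    by apply: c0 aw nB1a; rewrite ?sw ?n_gt1 ?leqnn // all_cat w1r.
  have w1B1 x : x \in w1 -> B1 x.
    by move=> xw; apply: contrapT => nx; apply: allB1; exists x; rewrite // mem_cat xw.
  have w2B1 x : x \in w2 -> B1 x.
    by move=> xw; apply: contrapT => nx; apply: allB1; exists x; rewrite // mem_cat xw orbT.
  have [f1 d1] := tev_ell s1 w1B1; have [f2 d2] := tev_ell s2 w2B1.
  have pos w T : size w = leaves T -> (forall x, x \in w -> B x) -> (0 < degw deg w)%N.
    move=> sw wB; apply: (degw_gt0 (basis_deg_gt0 B_indep B_homog) wB).
      exact/allP.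
    by rewrite sw leaves_gt0.
  rewrite degw_cat in wk; congr (_ *: _).
  transitivity (beta (tev t1 (map ell w1)) (tev t2 (map ell w2))).
    rewrite (beta_lead r2B f1 f2 wk); [|by rewrite d1|by rewrite d2].
    by apply: eq_bigr => b _; apply: eq_bigr => b' _; rewrite d1 d2.
  rewrite /D !map_cat !tev_cat ?size_map // /beta !h_tev //.
    by rewrite -wk -[X in (X < _)%N]add0n ltn_add2r (pos _ _ s1 w1B).
  by rewrite -wk -[X in (X < _)%N]addn0 ltn_add2l (pos _ _ s2 w2B).
transitivity (\sum_(T <- trees_height n) comm_coef n g T *:
    \sum_(w <- words r1 (leaves T) | degw deg w == k) c w *: D T w).
  rewrite [RHS]sum_trees_node => [|T Tn]; last by rewrite comm_coef_out ?scale0r.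
  rewrite comm_coef_leaf // scale0r add0r (lin_sum Lb_lin); apply: eq_big_seq => t1 t1n.
  rewrite (lin_sum Lb_lin); apply: eq_big_seq => t2 t2n.
  rewrite (linZ Lb_lin) (lin_sum Lb_lin) [in RHS]big_mkcond [leaves (Node t1 t2)]/= sum_words_cat.
  congr (_ *: _); apply: eq_big_seq => w1 w1r.
  rewrite (lin_sum Lb_lin); apply: eq_big_seq => w2 w2r.
  by rewrite (linZ Lb_lin) LbD.
transitivity (\sum_(q <- Y) q.1 *: \sum_(T <- trees_height n) g T *:
    \sum_(w <- words r1 (leaves T) | degw deg w == k) (\prod_(a <- w) coord a q.2) *: D T w).
  under [RHS]eq_bigr => q _ do rewrite scaler_sumr.
  rewrite exchange_big; apply: eq_bigr => T _.
  have [Tn|Tn] := eqVneq (leaves T) n; last first.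
    rewrite g_supp // [RHS]big1 => [|q _]; last by rewrite scale0r scaler0.
    rewrite big1_seq ?scaler0 // => w /andP[_]; rewrite mem_words /c => /andP[/eqP -> _].
    by rewrite (negPf Tn) scale0r.
  rewrite comm_coef_top //.
  under [RHS]eq_bigr => q _ do rewrite scalerA mulrC -scalerA scaler_sumr.
  rewrite -scaler_sumr exchange_big; congr (_ *: _).
  rewrite big_seq_cond [RHS]big_seq_cond; apply: eq_bigr => w /andP[].
  rewrite mem_words /c => /andP[/eqP -> _] _; rewrite Tn eqxx /power_coef scaler_suml.
  by apply: eq_bigr => q _; rewrite scalerA.
apply: big1 => q _.
have idC := homogeneous_identity charK r1 (h \o ell) deg (fun a => coord a q.2) k C_sat.
have idS := homogeneous_identity charK r1 ell deg (fun a => coord a q.2) k sub_sat.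
suff -> : \sum_(T <- trees_height n) g T *:
    \sum_(w <- words r1 (leaves T) | degw deg w == k) (\prod_(a <- w) coord a q.2) *: D T w
    = 0 - h 0 by rewrite (lin0 h_lin) subr0 scaler0.
rewrite -[X in X - _]idC -[X in h X]idS (lin_sum h_lin) -sumrB; apply: eq_bigr => T _.
rewrite (linZ h_lin) (lin_sum h_lin) -scalerBr -sumrB; congr (_ *: _).
by apply: eq_bigr => w _; rewrite (linZ h_lin) -scalerBr.
Qed.

End PartialHom.

(** The basis vectors of the graded subalgebra that complement the products; their lifts
    are the free generators. *)
Definition gen_sub : set A := [set b | B1 b /\ ~ B0 b].

Lemma B0_product b : B0 b -> exists p q x y, [/\ (p + q)%N = deg b, filt p.+1 x,
  filt q.+1 y & lead (deg b) (namul x y) = b].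
Proof.
move=> B0b; have [p [q [a [a' [[x fx xa] [y fy ya] bE]]]]] := B0_dec B0b.
exists p, q, x, y.
have pq : (p + q)%N = deg b.
  apply/esym/(degE B_indep B_homog (B1B (B01 B0b))).
  by rewrite bE; apply: homogM; [rewrite -xa|rewrite -ya]; apply: homog_delta.
by split=> //; rewrite -pq leadM // xa ya.
Qed.

Definition filt_gen k : set S := filt k `|`
  ([set s | exists b, [/\ gen_sub b, deg b = k & s = ell b]] `|`
   [set s | exists p q x y, [/\ (p + q)%N = k, filt p.+1 x, filt q.+1 y & s = namul x y]]).

(** Expand the leading component in [B1] and subtract the lifts of its terms: the vectors
    of [B0] lift to products, the others are generators, and the difference drops in the
    filtration. *)
Lemma filt_generated k s : filt k.+1 s -> span (filt_gen k) s.
Proof.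
move=> fs; pose v := lead k s; have gv : grS k v by exists s.
have /choice[u uP] b : exists u : S, B1 b -> deg b = k ->
    [/\ span (filt_gen k) u, filt k.+1 u & lead k u = b].
  have [[B1b bk]|nb] := pselect (B1 b /\ deg b = k); last first.
    by exists 0 => B1b bk; case: nb.
  have [B0b|nB0b] := pselect (B0 b).
    have [p [q [x [y [pq fx fy xy]]]]] := B0_product B0b; rewrite bk in pq xy.
    exists (namul x y) => _ _; split=> //.
      by apply: mem_span; right; right; exists p, q, x, y.
    by rewrite -pq; apply: filtM.
  exists (ell b) => _ _; split; last by rewrite -bk; apply: ell_lead.
    by apply: mem_span; right; left; exists b.
  by rewrite -bk; apply: ell_filt.
have [|r [r_uniq rB _ cov]] := @exists_cover _ _ _ B_indep B_span [:: v] [::].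
  by [].
have vE : covers B r v by apply: cov; rewrite mem_head.
pose s' := \sum_(b <- r) coord b v *: u b.
have us' : span (filt_gen k) s'.
  apply: span_sum => b br _; have [->|b0] := eqVneq (coord b v) 0.
    by rewrite scale0r; apply: span0.
  by have [B1b bk] := coord_gr_deg b0 gv; apply: spanZ; have [] := uP b B1b bk.
have fs' : filt k.+1 s'.
  apply: filt_sum => b _; have [->|b0] := eqVneq (coord b v) 0.
    by rewrite scale0r; apply: filt0.
  by have [B1b bk] := coord_gr_deg b0 gv; apply: filtZ; have [] := uP b B1b bk.
rewrite -[s](subrK s'); apply: spanD => //; apply: mem_span; left.
apply: filt_top; first exact: filtB.
rewrite (linB (lead_lin k)) (lin_sum (lead_lin k)) -/v {1}vE -sumrB big1 // => b _.
rewrite (linZ (lead_lin k)) -scalerBr.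
have [->|b0] := eqVneq (coord b v) 0; first by rewrite scale0r.
have [B1b bk] := coord_gr_deg b0 gv; have [_ _ ->] := uP b B1b bk.
by rewrite subrr scaler0.
Qed.

Section UniversalProperty.
Variables (C : naAlgType K) (C_sat : satisfies n g C) (f : A -> C).

(** The restriction of [h] to [filt k] is determined by these conditions, while its values
    elsewhere are arbitrary; total maps avoid a family of maps on subspaces. *)
Definition partial_hom k (h : S -> C) := [/\ linear h, hom_below k h &
  forall b, gen_sub b -> (deg b < k)%N -> h (ell b) = f b].

(** There are no elements of degree zero, so the factors of a nonzero product have smaller
    degree than the product. *)
Lemma filt_split p q k x y : filt p.+1 x -> filt q.+1 y -> (p + q)%N = k ->
  (filt k x /\ filt k y) \/ (x = 0 \/ y = 0).
Proof.
move=> fx fy <-; case: q fy => [|q] fy; first by right; right; apply: filt1.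
case: p fx => [|p] fx; first by right; left; apply: filt1.
left; split; [apply: filt_mono fx|apply: filt_mono fy]; last by rewrite addSn ltnS leq_addl.
by rewrite addnS ltnS leq_addr.
Qed.

Lemma partial_hom_uniq k h h' : partial_hom k h -> partial_hom k h' ->
  forall s, filt k s -> h s = h' s.
Proof.
move=> [hl hm hf] [hl' hm' hf'].
suff main m : (m <= k)%N -> forall s, filt m s -> h s = h' s by apply: main.
elim: m => [_ s fs|m IHm mk s /filt_generated].
  by rewrite (filt1 (filt_mono (leq0n 1) fs)) (lin0 hl) (lin0 hl').
have {}IHm := IHm (ltnW mk).
move: s; apply: span_min.
- by rewrite (lin0 hl) (lin0 hl').
- by move=> a x y Hx Hy; rewrite hl hl' Hx Hy.
- move=> s [fs|[[b [gb bm ->]]|[p [q [x [y [pq fx fy ->]]]]]]].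
  + exact: IHm.
  + by rewrite hf ?bm // hf' ?bm.
  + have [[fx' fy']|[->|->]] := filt_split fx fy pq.
    * by rewrite (hm _ _ _ _ fx fy) ?(hm' _ _ _ _ fx fy) ?pq // !IHm.
    * by rewrite namul0l (lin0 hl) (lin0 hl').
    * by rewrite namul0r (lin0 hl) (lin0 hl').
Qed.

(** The values of the extension are prescribed by a linear relation [R]: those of [h] on
    [filt k], those of [f] on the generators of degree [k], and the products of values of
    [h] on products of degree [k].  That [R] is single-valued splits in two: generators
    are independent of products modulo lower degree, and relations between products are
    respected by [obstruction_vanishes]. *)
Lemma partial_hom_step k h : partial_hom k h -> exists h', partial_hom k.+1 h'.
Proof.
move=> [hl hm hf].
have [L L_lin L_gen] := basis_map B_indep B_span ell.
have [F F_lin F_gen] := basis_map B_indep B_span f.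
pose Yk : set A := [set b | gen_sub b /\ deg b = k].
pose Zok (Z : seq (nat * nat * (S * S))) := forall z, z \in Z ->
  [/\ (z.1.1 + z.1.2)%N = k, filt z.1.1.+1 z.2.1 & filt z.1.2.+1 z.2.2].
pose R (v : S) (w : C) := exists s u Z, [/\ filt k s, span Yk u, Zok Z,
  v = s + L u + \sum_(z <- Z) namul z.2.1 z.2.2 &
  w = h s + F u + \sum_(z <- Z) namul (h z.2.1) (h z.2.2)].
have YkB : Yk `<=` B by move=> b [[/B1B]].
have lead_L u : span Yk u -> filt k.+1 (L u) /\ lead k (L u) = u.
  move: u; apply: span_min.
  - by rewrite (lin0 L_lin); split; [apply: filt0|apply: (lin0 (lead_lin k))].
  - move=> a x y [fx dx] [fy dy]; rewrite L_lin; split; first exact: filtP.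
    by rewrite (lead_lin k) dx dy.
  - move=> b Yb; rewrite L_gen; last exact: YkB.
    by case: Yb => -[B1b _] <-; split; [apply: ell_filt|apply: ell_lead].
have [|||h' h'l h'R] := @linear_extension K S C R.
- exists 0, 0, [::]; split=> //; first exact: filt0.
  + exact: span0.
  + by rewrite (lin0 L_lin) big_nil !addr0.
  + by rewrite (lin0 hl) (lin0 F_lin) big_nil !addr0.
- move=> a v w v' w' [s [u [Z [fs Yu ZP -> ->]]]] [s' [u' [Z' [fs' Yu' ZP' -> ->]]]].
  exists (a *: s + s'), (a *: u + u'),
    ([seq (z.1, (a *: z.2.1, z.2.2)) | z <- Z] ++ Z'); split.
  + exact: filtP.
  + exact: spanP.
  + move=> z; rewrite mem_cat => /orP[/mapP[y /ZP[yk fy1 fy2] ->] /=|]; last exact: ZP'.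
    by split=> //; apply: filtZ.
  + rewrite big_cat big_map L_lin /= !scalerDr scaler_sumr.
    under [X in _ = _ + (X + _)]eq_bigr => z _ do rewrite namulZl.
    by rewrite [LHS]addrACA; congr (_ + _); apply: addrACA.
  + rewrite big_cat big_map F_lin hl /= !scalerDr scaler_sumr.
    under [X in _ = _ + (X + _)]eq_bigr => z _ do rewrite (linZ hl) namulZl.
    by rewrite [LHS]addrACA; congr (_ + _); apply: addrACA.
- move=> w [s [u [Z [fs Yu ZP E ->]]]].
  have [fL dL] := lead_L u Yu.
  have dec : span B0 (\sum_(z <- Z) lead k (namul z.2.1 z.2.2)).
    apply: span_sum => z zZ _; have [zk fx fy] := ZP z zZ.
    rewrite -zk leadM //; apply: B0_span.
    by exists z.1.1, z.1.2, (lead z.1.1 z.2.1), (lead z.1.2 z.2.2); split=> //;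
      [exists z.2.1|exists z.2.2].
  have := congr1 (lead k) E; rewrite (lin0 (lead_lin k)) !(linD (lead_lin k)) dL.
  rewrite (lead_filt fs) add0r (lin_sum (lead_lin k)) => /esym/eqP.
  rewrite addr_eq0 => /eqP uE.
  (* [u] is both a combination of generators and, up to sign, of products *)
  have u0 : u = 0.
    apply: (coord_inj B_indep B_span) => b Bb; rewrite (lin0 (coordL b)).
    have [B0b|nB0b] := pselect (B0 b).
      apply: (coord_eq0 B_indep B_span YkB _ Yu).
      by move=> [[_ nB0b] _]; apply: nB0b.
    rewrite uE -scaleN1r (linZ (coordL b)).
    rewrite (coord_eq0 B_indep B_span (subset_trans B01 B1B) nB0b dec).
    by rewrite scaler0.
  move: E; rewrite u0 (lin0 L_lin) (lin0 F_lin) !addr0 => /esym/eqP.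
  rewrite addrC addr_eq0 => /eqP sE.
  rewrite (obstruction_vanishes C_sat hl hm ZP); last first.
    by rewrite sE -scaleN1r; apply: filtZ.
  by rewrite sE -(linD hl) subrr (lin0 hl).
have h'h s : filt k s -> h' s = h s.
  move=> fs; apply: h'R; exists s, 0, [::]; split=> //; first exact: span0.
    by rewrite (lin0 L_lin) big_nil !addr0.
  by rewrite (lin0 F_lin) big_nil !addr0.
exists h'; split=> //.
- move=> p q x y fx fy; rewrite ltnS leq_eqVlt => /orP[/eqP pq|pq].
    have [[fx' fy']|[->|->]] := filt_split fx fy pq; last 2 first.
    + by rewrite namul0l (lin0 h'l) namul0l.
    + by rewrite namul0r (lin0 h'l) namul0r.
    rewrite (h'h x) // (h'h y) //; apply: h'R.
    exists 0, 0, [:: (p, q, (x, y))]; split.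
    + exact: filt0.
    + exact: span0.
    + by move=> z; rewrite inE => /eqP ->.
    + by rewrite (lin0 L_lin) big_seq1 !add0r.
    + by rewrite (lin0 F_lin) (lin0 hl) big_seq1 !add0r.
  rewrite !h'h.
  + exact: hm fx fy pq.
  + by apply: filt_mono fy; apply: leq_ltn_trans pq; apply: leq_addl.
  + by apply: filt_mono fx; apply: leq_ltn_trans pq; apply: leq_addr.
  + by apply: filt_mono (filtM fx fy).
- move=> b gb; rewrite ltnS leq_eqVlt => /orP[/eqP bk|bk].
    apply: h'R; exists 0, b, [::]; split=> //.
    + exact: filt0.
    + by apply: mem_span.
    + by rewrite L_gen ?big_nil ?add0r ?addr0 //; apply: B1B; case: gb.
    + by rewrite F_gen ?big_nil ?(lin0 hl) ?add0r ?addr0 //; apply: B1B; case: gb.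
  rewrite h'h ?hf //; apply: filt_mono bk _; apply: ell_filt; by case: gb.
Qed.

Lemma partial_hom_exists k : exists h, partial_hom k h.
Proof.
elim: k => [|k [h]]; last exact: partial_hom_step.
exists (fun=> 0); split=> // a x y.
by rewrite scaler0 addr0.
Qed.

Lemma partial_hom_mono k k' h : (k <= k')%N -> partial_hom k' h -> partial_hom k h.
Proof.
move=> kk' [hl hm hf]; split=> // [p q x y fx fy pq|b gb bk].
  by apply: hm fx fy _; apply: leq_trans kk'.
by apply: hf => //; apply: leq_trans kk'.
Qed.

(** The partial homomorphisms agree where both are determined, so they glue. *)
Lemma hom_extends : exists! h : S -> C,
  is_alg_hom h /\ forall b, gen_sub b -> h (ell b) = f b.
Proof.
have /choice[H HP] := partial_hom_exists.
have /choice[N NP] := filt_exists.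
pose h s := H (N s) s.
have hE k s : filt k s -> h s = H k s.
  move=> fs; have [kN|Nk] := leqP k (N s).
    exact: (partial_hom_uniq (partial_hom_mono kN (HP _)) (HP _) fs).
  exact: (partial_hom_uniq (HP _) (partial_hom_mono (ltnW Nk) (HP _)) (NP s)).
exists h; split.
  split; first split.
  - move=> a x y; pose m := maxn (N x) (N y).
    have fx : filt m x by apply: filt_mono (NP x); apply: leq_maxl.
    have fy : filt m y by apply: filt_mono (NP y); apply: leq_maxr.
    rewrite (hE m x fx) (hE m y fy) (hE m _ (filtP a fx fy)).
    by have [Hl _ _] := HP m; rewrite Hl.
  - move=> x y; pose m := (N x + N y).+1.
    have fx : filt m x by apply: filt_mono (NP x); rewrite leqW // leq_addr.
    have fy : filt m y by apply: filt_mono (NP y); rewrite leqW // leq_addl.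
    have fx1 : filt (N x).+1 x by apply: filt_mono (NP x).
    have fy1 : filt (N y).+1 y by apply: filt_mono (NP y).
    rewrite (hE m x fx) (hE m y fy) (hE m _ (filtM fx1 fy1)).
    by have [_ Hm _] := HP m; apply: Hm fx1 fy1 _.
  - move=> b gb; have fb := ell_filt gb.1.
    by rewrite (hE _ _ fb); have [_ _ ->] := HP (deg b).+1.
move=> h' [[h'l h'm] h'f]; apply/funext => s.
apply: (partial_hom_uniq (HP (N s)) _ (NP s)).
by split=> // b gb _; apply: h'f.
Qed.
End UniversalProperty.

Lemma sub_free_on :
  free_on (satisfies n g) (fun b : {b : A | gen_sub b} => ell (sval b)).
Proof.
split; first exact: sub_sat.
move=> C C_sat f.
pose f' b := if pselect (gen_sub b) is left gb then f (exist _ b gb) else 0.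
have f'E (b : {b : A | gen_sub b}) : f' (sval b) = f b.
  case: b => b gb; rewrite /f' /=; case: pselect => [gb'|//].
  by congr (f (exist _ b _)); apply: Prop_irrelevance.
have [h [[hh hf] hU]] := hom_extends C_sat f'.
exists h; split; first by split=> //; apply/funext => b /=; rewrite hf ?f'E //; case: b.
move=> h' [hh' h'f]; apply: hU; split=> // b gb.
by rewrite -[b in ell b]/(sval (exist _ b gb)) -[b in f' b]/(sval (exist _ b gb)) f'E -h'f.
Qed.
End Subalgebra.

Lemma subalgebra_free (S : naAlgType K) (iota : S -> A) :
  comm_coef n g (Node Leaf Leaf) != 0 -> is_alg_hom iota -> injective iota ->
  is_free (satisfies n g) S.
Proof.
move=> g_generic iota_hom iota_inj.
have [B0 [B1 [B [[B01 B1B B0d] [B1g Bh] Bi [B0s B1s Bs]]]]] := adapted_basis iota_hom.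
have [ell ellP] := lift_exists B1B B1g Bh Bi.
exists {b : A | gen_sub B0 B1 b}, (fun b => ell (sval b)).
apply: (@sub_free_on g_generic S iota iota_hom iota_inj B0 B1 B) => //.
- by move=> b /ellP[].
- by move=> b /ellP[].
Qed.
End FreeAlgebra.

(** * The open set *)

Section OpenSet.
Variables (K : fieldType) (n : nat).
Implicit Types b : {ffun ptree n -> K}.

(** Each derivation step is a difference of two coefficients, so the result is a linear
    form in the coordinates. *)
Lemma comm_coef_polynomial T : exists p : {mpoly K[#|ptree n|]},
  forall b, p.@[fun k => b (enum_val k)] = comm_coef n (tree_coef b) T.
Proof.
rewrite /comm_coef; case: (leaves T <= n)%N; last by exists 0 => b; rewrite meval0.
move: (n - leaves T)%N => j; elim: j T => [|j IHj] T /=; last first.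
  have [[p pE] [q qE]] := (IHj (Node Leaf T), IHj (Node T Leaf)).
  by exists (p - q) => b; rewrite mevalB pE qE.
rewrite /tree_coef; case: insubP => [t _ _|_]; last by exists 0 => b; rewrite meval0.
by exists 'X_(enum_rank t) => b; rewrite mevalXU enum_rankK.
Qed.

(** The right comb with [j + 1] leaves; the identity with this single monomial is generic. *)
Fixpoint comb j : bintree := if j is j'.+1 then Node Leaf (comb j') else Leaf.

Lemma leaves_comb j : leaves (comb j) = j.+1.
Proof. by elim: j => //= j ->; rewrite add1n. Qed.

(** Removing a leaf on the left of a right comb gives a right comb, and no right comb with
    more than two leaves has a leaf on the right of its root. *)
Lemma iter_leaf_comm_comb m j T : (1 < leaves T)%N ->
  iter j (@leaf_comm K) (fun T' => (T' == comb (j + m))%:R) T = (T == comb m)%:R.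
Proof.
elim: j T m => //= j IHj T m T1; rewrite /leaf_comm.
have -> : (fun T' => (T' == comb (j.+1 + m))%:R : K) = (fun T' => (T' == comb (j + m.+1))%:R).
  by rewrite addSnnS.
rewrite !IHj /=; try by rewrite ?addn1 ?add1n ltnS leaves_gt0.
have -> : (Node T Leaf == Node Leaf (comb m)) = false.
  by apply/eqP => -[TL _]; rewrite TL in T1.
rewrite subr0; congr (nat_of_bool _)%:R.
by apply/eqP/eqP => [[]//|->].
Qed.

Lemma exists_generic : (1 < n)%N ->
  exists b, comm_coef n (tree_coef b) (Node Leaf Leaf) != 0.
Proof.
move=> n1; exists [ffun t => (val t == comb n.-1)%:R].
rewrite (_ : tree_coef _ = fun T => (T == comb (n - 2 + 1))%:R).
  by rewrite /comm_coef /= n1 iter_leaf_comm_comb // oner_neq0.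
have -> : (n - 2 + 1 = n.-1)%N by rewrite addn1 subnSK ?subn1.
apply/funext => T; rewrite /tree_coef; case: insubP => [t Tn tT|Tn].
  by rewrite ffunE tT.
case: eqP => // TE; case/negP: Tn; rewrite TE leaves_comb prednK //.
exact: ltnW.
Qed.

End OpenSet.

Theorem theorem10p1 (K : fieldType) (charK : [pchar K] =i pred0)
    (n : nat) (n_gt2 : (2 < n)%N) :
  exists U : set {ffun ptree n -> K},
    [/\ zariski_open U,
        exists b : {ffun ptree n -> K}, U b
      & forall b : {ffun ptree n -> K}, U b ->
          nielsen_schreier (tree_variety b)].
Proof.
have n1 : (1 < n)%N := ltnW n_gt2.
exists (fun b => comm_coef n (tree_coef b) (Node Leaf Leaf) != 0); split.
- have [p pE] := comm_coef_polynomial K n (Node Leaf Leaf).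
  exists (fun q => q = p) => b; rewrite -pE.
  by split=> [? |[q ->]]; [exists p|].
- exact: exists_generic.
- move=> b b_generic A [X [gen A_free]] S.
  have VE : tree_variety b = satisfies n (tree_coef b).
    by apply/funext => C; apply/propext; apply: tree_varietyE.
  rewrite VE in A_free *.
  have coef0 T : leaves T != n -> tree_coef b T = 0 by apply: tree_coef0.
  have [delta delta_grading] := grading_exists charK A_free.
  apply: (@subalgebra_free _ charK _ _ n1 coef0 _ _ _ A_free _ delta_grading
    (subalg_type S) (val : subalg_type S -> A) b_generic).
  + by split=> [a x y|x y //]; apply: subalg_valP.
  + exact: val_inj.
Qed.
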